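(* The group $(\delta+\mathbb{K}^m_{LC}\langle\langle X\rangle\rangle,\circ,\delta)$ is an analytic Lie group with respect to the Silva topology.
   Context: $\mathbb{K}\in\{\mathbb{R},\mathbb{C}\}$. $X=\{x_0,x_1,\ldots,x_m\}$ is a finite alphabet, $X^\ast$ its words (including $\emptyset$), $|\eta|$ the length. $\mathbb{K}^m\langle\langle X\rangle\rangle$ is the space of maps $X^\ast\to\mathbb{K}^m$. For $M>0$, $\|c\|_{\ell_\infty,M}=\sup_\eta|(c,\eta)|/(M^{|\eta|}|\eta|!)$ ($|z|=\max_i|z_i|$), $\ell_{\infty,M}(X^\ast,\mathbb{K}^m)$ the Banach space of series with finite norm, and $\mathbb{K}^m_{LC}\langle\langle X\rangle\rangle=\bigcup_{M>0}\ell_{\infty,M}(X^\ast,\mathbb{K}^m)$ with the Silva topology (locally convex inductive limit). $\delta$ is a formal symbol (the generating series of the identity operator), and $\delta+\mathbb{K}^m_{LC}\langle\langle X\rangle\rangle=\{c_\delta:=\delta+c\}$ is identified with $\mathbb{K}^m_{LC}\langle\langle X\rangle\rangle$ as a manifold (an affine space). The shuffle product $\sqcup\!\sqcup$ is determined on words by $(x_i\eta)\sqcup\!\sqcup(x_j\xi)=x_i(\eta\sqcup\!\sqcup(x_j\xi))+x_j((x_i\eta)\sqcup\!\sqcup\xi)$, $\eta\sqcup\!\sqcup\emptyset=\emptyset\sqcup\!\sqcup\eta=\eta$. Mixed composition: for $d$ with components $d[1],\ldots,d[m]$ and $d[0]:=0$, let $\phi_d(\emptyset)=\mathrm{id}$,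 $\phi_d(x_i\eta)=\phi_d(x_i)\circ\phi_d(\eta)$, $\phi_d(x_i)(e)=x_ie+x_0(d[i]\sqcup\!\sqcup e)$, and $c\,\tilde\circ\,d_\delta=\sum_\eta(c,\eta)\phi_d(\eta)(\mathbf{1})$ with $\mathbf{1}=1\cdot\emptyset$. The group product is $c_\delta\circ d_\delta=\delta+d+c\,\tilde\circ\,d_\delta$, with identity $\delta$; this makes $\delta+\mathbb{K}^m_{LC}\langle\langle X\rangle\rangle$ a group. An analytic Lie group is a group with an analytic manifold structure making multiplication and inversion analytic, where analyticity is in the Bastiani sense (complex analytic = continuous with continuous iterated directional derivatives of all orders over $\mathbb{C}$; real analytic = extends to a complex analytic map on an open neighbourhood in the complexification). *)

(* Defs.v *)
From HB Require Import structures.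
From mathcomp Require Import all_boot all_order all_algebra.
From mathcomp Require Import reals.
From mathcomp Require Import complex.
Set Implicit Arguments. Unset Strict Implicit. Unset Printing Implicit Defensive.
Import Order.TTheory GRing.Theory Num.Theory.
Local Open Scope ring_scope.

(*  Alphabet X = {x_0,...,x_m} is 'I_m.+1 ; words X^* are seq 'I_m.+1.      *)
(*  A series in K^m<<X>> is a map  word -> ('I_m -> K)  (component j of    *)
(*  (c,eta) is  c eta j, j : 'I_m standing for component j+1).              *)

Section Series.
Variables (K : numFieldType) (m : nat).

Definition word := seq 'I_m.+1.
Definition ser := word -> 'I_m -> K.
Definition sser := word -> K.

(* shuffle product of two words, as the list (multiset) of the words
   occurring in it:  (x_i u) sh (x_j v) = x_i (u sh x_j v) + x_j (x_i u sh v),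
   u sh [] = [] sh u = u *)
Fixpoint shw (u v : word) : seq word :=
  match u with
  | [::] => [:: v]
  | a :: u' =>
    let fix aux (v : word) : seq word :=
      match v with
      | [::] => [:: u]
      | b :: v' => map (cons a) (shw u' v) ++ map (cons b) (aux v')
      end in aux v
  end.

(* bilinear extension to scalar series: the coefficient of nu in
   sum_{u,v} (a,u)(b,v) u sh v ; only |u|+|v| = |nu| contribute *)
Definition shuffle (a b : sser) : sser := fun nu =>
  \sum_(k < (size nu).+1) \sum_(u : k.-tuple 'I_m.+1)
     \sum_(v : (size nu - k).-tuple 'I_m.+1)
        (a u * b v) *+ count_mem nu (shw u v).

Definition lcons (i : 'I_m.+1) (e : sser) : sser := fun nu =>
  match nu with [::] => 0 | j :: nu' => if j == i then e nu' else 0 end.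

Definition comp (d : ser) (i : 'I_m.+1) : sser := fun w =>
  match unlift ord0 i with Some j => d w j | None => 0 end.

Definition phi_letter (d : ser) (i : 'I_m.+1) (e : sser) : sser := fun nu =>
  lcons i e nu + lcons ord0 (shuffle (comp d i) e) nu.

Definition one_ser : sser := fun nu => if nu is [::] then 1 else 0.

(* phi_d(emptyword) = id, phi_d(x_i eta) = phi_d(x_i) o phi_d(eta);
   phi d eta = phi_d(eta)(1) *)
Definition phi (d : ser) (eta : word) : sser := foldr (phi_letter d) one_ser eta.

(* mixed composition c ~o d_delta = sum_eta (c,eta) phi_d(eta)(1).
   phi_d(eta)(1) is supported on words of length >= |eta|, so the
   coefficient at nu is the finite sum over |eta| <= |nu|. *)
Definition mixcomp (c d : ser) : ser := fun nu j =>
  \sum_(k < (size nu).+1) \sum_(eta : k.-tuple 'I_m.+1) c eta j * phi d eta nu.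

(* group product in the affine coordinate c_delta = delta + c :
   c_delta o d_delta = delta + (d + c ~o d_delta) ; identity delta <-> 0 *)
Definition gmul (c d : ser) : ser := fun nu j => d nu j + mixcomp c d nu j.
Definition gunit : ser := fun _ _ => 0.

Definition bounded_by (M B : K) (c : ser) : Prop :=
  forall nu j, `|c nu j| <= B * M ^+ size nu * (size nu)`!%:R.

Definition LC (c : ser) : Prop := exists M B, 0 < M /\ bounded_by M B c.

(* 0-neighbourhoods of the locally convex inductive limit (Silva) topology:
   absolutely convex subsets V of K^m_LC<<X>> such that V meets every
   l_{infty,M} in a 0-neighbourhood of its Banach topology. *)
Definition nbhd0 (V : ser -> Prop) : Prop :=
  (forall c, V c -> LC c) /\
  (forall (a b : K) x y, `|a| + `|b| <= 1 -> V x -> V y ->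
       V (fun nu j => a * x nu j + b * y nu j)) /\
  (forall M : K, 0 < M -> exists2 e : K, 0 < e & forall c, bounded_by M e c -> V c).

Definition pt (n : nat) := 'I_n -> ser.
Definition LCp n (x : pt n) : Prop := forall i, LC (x i).
Definition nbhdfam n (V : 'I_n -> ser -> Prop) : Prop := forall i, nbhd0 (V i).
Definition near n (x y : pt n) (V : 'I_n -> ser -> Prop) : Prop :=
  forall i, V i (fun nu j => y i nu j - x i nu j).

Definition openp n (U : pt n -> Prop) : Prop :=
  (forall x, U x -> LCp x) /\
  (forall x, U x -> exists V, nbhdfam V /\
      forall y, LCp y -> near x y V -> U y).

Definition axpy n (x : pt n) (t : K) (v : pt n) : pt n :=
  fun i nu j => x i nu j + t * v i nu j.

Definition dirderiv n p (U : pt n -> Prop) (g : pt n -> pt p) (x v : pt n)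
    (L : pt p) : Prop :=
  forall W, nbhdfam W -> exists2 del : K, 0 < del &
    forall t : K, 0 < `|t| < del -> U (axpy x t v) ->
      near L (fun i nu j => (g (axpy x t v) i nu j - g x i nu j) / t) W.

(* Bastiani C^infty over K on the open set U: all iterated directional
   derivatives d^k f(x; v_0,...,v_{k-1}) exist and the maps
   U x E^{n k} -> E^p, (x, v) |-> d^k f(x; v) are continuous (k = 0: f). *)
Definition bastiani_smooth n p (U : pt n -> Prop) (f : pt n -> pt p) : Prop :=
  exists D : nat -> pt n -> (nat -> pt n) -> pt p,
    (forall x vs, U x -> D 0%N x vs = f x) /\
    (forall k x vs, U x -> (forall l, LCp (vs l)) -> LCp (D k x vs)) /\
    (forall k x vs, U x -> (forall l, LCp (vs l)) ->
       dirderiv U (fun y => D k y vs) x (vs k) (D k.+1 x vs)) /\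
    (forall k x vs, U x -> (forall l, LCp (vs l)) ->
       forall W, nbhdfam W -> exists V0, exists Vs : nat -> 'I_n -> ser -> Prop,
         nbhdfam V0 /\ (forall l, nbhdfam (Vs l)) /\
         forall y ws, U y -> (forall l, LCp (ws l)) -> near x y V0 ->
           (forall l, (l < k)%N -> near (vs l) (ws l) (Vs l)) ->
           near (D k x vs) (D k y ws) W).

Definition Kanalytic n p (U : pt n -> Prop) (f : pt n -> pt p) : Prop :=
  openp U /\ bastiani_smooth U f.

Definition eqs (c d : ser) : Prop := forall nu j, c nu j = d nu j.

Definition is_group (mul : ser -> ser -> ser) (e : ser) (inv : ser -> ser) : Prop :=
  (forall c d, LC c -> LC d -> LC (mul c d)) /\ LC e /\
  (forall c, LC c -> LC (inv c)) /\
  (forall a b c, LC a -> LC b -> LC c -> eqs (mul (mul a b) c) (mul a (mul b c))) /\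
  (forall c, LC c -> eqs (mul e c) c /\ eqs (mul c e) c) /\
  (forall c, LC c -> eqs (mul c (inv c)) e /\ eqs (mul (inv c) c) e).

(* The manifold is the affine space delta + K^m_LC<<X>> with its single global
   chart c_delta |-> c; a Lie group for the analyticity notion [an]:
   multiplication E x E -> E and inversion E -> E are [an]. *)
Definition Lie_group
    (an : forall n p, (pt n -> Prop) -> (pt n -> pt p) -> Prop)
    (mul : ser -> ser -> ser) (e : ser) : Prop :=
  exists inv : ser -> ser, is_group mul e inv /\
    an 2%N 1%N (@LCp 2) (fun x _ => mul (x ord0) (x ord_max)) /\
    an 1%N 1%N (@LCp 1) (fun x _ => inv (x ord0)).

End Series.

Section RealAnalytic.
Variables (R : realType) (m : nat).
Local Open Scope complex_scope.

Definition cplx n (x : pt R m n) : pt R[i] m n := fun i nu j => (x i nu j)%:C.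

Definition real_analytic n p (U : pt R m n -> Prop) (f : pt R m n -> pt R m p) : Prop :=
  openp U /\
  exists (V : pt R[i] m n -> Prop) (g : pt R[i] m n -> pt R[i] m p),
    Kanalytic V g /\ (forall x, U x -> V (cplx x)) /\
    (forall x, U x -> forall i nu j, g (cplx x) i nu j = cplx (f x) i nu j).

End RealAnalytic.

(* Main.v *)
Require Import Defs.
From HB Require Import structures.
From mathcomp Require Import all_boot all_order all_algebra.
From mathcomp Require Import reals.
From mathcomp Require Import complex.
From mathcomp Require Import boolp ring.

(* Reading off first letters turns the shuffle product and the mixed composition
   into recursions on the length of the word at which the coefficient is taken,
   and all algebraic identities follow by induction on this length.  The inverse
   of [delta + c] is the fixed point of [e = - c ~o e_delta].

   Convergence is obtained by comparison with the powers of
   [H(t) = (1 - 2 lam t)^(-1/2)], which satisfies [H' = lam H^3]: for [lam] large,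
   composition with a series majorized by [B H] maps series of growth
   [B M^n n!] to series majorized by [B H].

   The coefficients of the product and of the inverse are polynomials in the
   coefficients of the arguments, and replacing the constants of these polynomials
   by their norms still gives maps preserving local convergence.  The boxes
   [|c_w| <= a_|w| |w|!] with [a] of superexponential growth form a basis of
   0-neighbourhoods of the Silva topology, so that continuity of a polynomial map
   and of its derivatives can be proved coefficientwise, by means of the
   majorants.  The real maps are restrictions of the complex ones. *)

Set Implicit Arguments. Unset Strict Implicit. Unset Printing Implicit Defensive.
Import Order.TTheory GRing.Theory Num.Theory.
Local Open Scope ring_scope.

(** * Shuffle product and mixed composition *)

Section WordSums.
Variables (K : numFieldType) (m : nat).
Implicit Types (F G : word m -> K) (w : word m).

Definition sumw n F : K := \sum_(v : n.-tuple 'I_m.+1) F v.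

Lemma eq_sumw n F G : F =1 G -> sumw n F = sumw n G.
Proof. by move=> FG; apply: eq_bigr => v _; rewrite FG. Qed.

Lemma eq_sumw_size n F G :
  (forall w, size w = n -> F w = G w) -> sumw n F = sumw n G.
Proof. by move=> FG; apply: eq_bigr => v _; rewrite FG ?size_tuple. Qed.

Lemma sumw0 F : sumw 0 F = F [::].
Proof.
rewrite /sumw (bigD1 [tuple]) //= big1 ?addr0 // => v /eqP[].
exact: tuple0.
Qed.

Lemma sumwS n F : sumw n.+1 F = \sum_x sumw n (fun v => F (x :: v)).
Proof.
rewrite /sumw pair_big /=.
rewrite (reindex (fun p : 'I_m.+1 * n.-tuple 'I_m.+1 => cons_tuple p.1 p.2)) //=.
exists (fun t => (thead t, behead_tuple t)) => [[x v]|v] _ /=.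
  by congr (_, _); apply: val_inj.
by rewrite [RHS]tuple_eta; apply: val_inj.
Qed.

Lemma sumwD n F G : sumw n (fun w => F w + G w) = sumw n F + sumw n G.
Proof. exact: big_split. Qed.

Lemma sumw_const0 n : sumw n (fun=> 0) = 0.
Proof. by rewrite /sumw big1. Qed.

Lemma sumwMl n a F : sumw n (fun w => a * F w) = a * sumw n F.
Proof. by rewrite /sumw big_distrr. Qed.

Lemma sumw_sum n (I : finType) (F : I -> word m -> K) :
  sumw n (fun w => \sum_i F i w) = \sum_i sumw n (F i).
Proof. exact: exchange_big. Qed.

End WordSums.

(** The left shift $x^{-1}(c)$, a derivation of the shuffle algebra and the vehicle of the
    recursions below. *)
Definition lder m (T : Type) (x : 'I_m.+1) (c : word m -> T) : word m -> T :=
  fun w => c (x :: w).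

Section Shuffle.
Variables (K : numFieldType) (m : nat).
Implicit Types (a b c e : sser K m) (u v w nu : word m).

Lemma count_map_cons (x y : 'I_m.+1) nu (s : seq (word m)) :
  count_mem (x :: nu) (map (cons y) s) = ((y == x) * count_mem nu s)%N.
Proof.
rewrite count_map; case: eqP => [->|ne].
  by rewrite mul1n; apply: eq_count => w /=; rewrite eqseq_cons eqxx.
rewrite mul0n; apply/eqP; rewrite -leqn0 leqNgt -has_count; apply/hasPn => w _.
by rewrite /= eqseq_cons; apply/negP => /andP[/eqP].
Qed.

Lemma shw_nilr u : shw u [::] = [:: u].
Proof. by case: u. Qed.

Lemma count_shw_cons x nu u v :
  count_mem (x :: nu) (shw u v) =
  ((if u is y :: u' then (y == x) * count_mem nu (shw u' v) else 0) +
   (if v is y :: v' then (y == x) * count_mem nu (shw u v') else 0))%N.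
Proof.
case: u => [|y u].
  by case: v => [|z v] //=; rewrite !addn0 eqseq_cons mulnb.
case: v => [|z v]; last by rewrite /= count_cat !count_map_cons.
by rewrite !shw_nilr /= !addn0 eqseq_cons mulnb.
Qed.

Lemma shuffleE a b nu : shuffle a b nu =
  \sum_(k < (size nu).+1) sumw k (fun u => sumw (size nu - k)
    (fun v => (a u * b v) *+ count_mem nu (shw u v))).
Proof. by []. Qed.

Lemma shuffle_nil a b : shuffle a b [::] = a [::] * b [::].
Proof.
by rewrite shuffleE big_ord1 !sumw0.
Qed.

(** A word of [shw u v] starting with [x] takes this letter from [u] or from [v]; [Lf] and [Rf]
    collect the two cases. *)
Lemma shuffle_cons a b x nu :
  shuffle a b (x :: nu) = shuffle (lder x a) b nu + shuffle a (lder x b) nu.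
Proof.
pose n := size nu.
pose Lf u v := (a u * b v) *+
  (if u is y :: u' then (y == x) * count_mem nu (shw u' v) else 0)%N.
pose Rf u v := (a u * b v) *+
  (if v is y :: v' then (y == x) * count_mem nu (shw u v') else 0)%N.
have -> : shuffle a b (x :: nu) =
    (\sum_(k < n.+2) sumw k (fun u => sumw (n.+1 - k) (Lf u))) +
    (\sum_(k < n.+2) sumw k (fun u => sumw (n.+1 - k) (Rf u))).
  rewrite shuffleE -big_split; apply: eq_bigr => k _.
  rewrite /= -sumwD; apply: eq_sumw => u; rewrite -sumwD; apply: eq_sumw => v.
  by rewrite count_shw_cons mulrnDr.
rewrite !shuffleE -/n; congr (_ + _).
  (* For [k = 0] the word [u] is empty and [Lf] vanishes; the other lengths are those of words
     [x :: u]. *)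
  rewrite big_ord_recl sumw0 [X in X + _](_ : _ = 0) ?add0r; last first.
    by rewrite /sumw big1.
  apply: eq_bigr => k _; rewrite subSS.
  rewrite (sumwS k (fun u => sumw (n - k) (Lf u))) (bigD1 x) //=.
  rewrite [X in _ + X]big1 ?addr0.
    apply: eq_sumw => u; apply: eq_sumw => v.
    by rewrite /Lf eqxx mul1n.
  move=> y /negPf yx; rewrite /sumw big1 // => u _; rewrite big1 // => v _.
  by rewrite /Lf yx mul0n mulr0n.
(* Symmetrically, the last index leaves [v] empty and [Rf] vanishes. *)
rewrite big_ord_recr /= subnn [X in _ + X](_ : _ = 0) ?addr0; last first.
  by rewrite /sumw big1 // => u _; rewrite -/(sumw 0 (Rf u)) sumw0 /Rf mulr0n.
apply: eq_bigr => k _; apply: eq_sumw => u.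
have Hk : (k <= n)%N by rewrite -ltnS.
rewrite (subSn Hk) sumwS (bigD1 x) //= [X in _ + X]big1 ?addr0.
  by apply: eq_sumw => v; rewrite /Rf eqxx mul1n.
move=> y /negPf yx; rewrite /sumw big1 // => v _.
by rewrite /Rf yx mul0n mulr0n.
Qed.

Lemma eq_shuffle a b a' b' nu :
  (forall w, (size w <= size nu)%N -> a w = a' w) ->
  (forall w, (size w <= size nu)%N -> b w = b' w) ->
  shuffle a b nu = shuffle a' b' nu.
Proof.
elim: nu a b a' b' => [|x nu IH] a b a' b' Ha Hb.
  by rewrite !shuffle_nil Ha // Hb.
rewrite !shuffle_cons; congr (_ + _); apply: IH => w Hw; rewrite /lder;
  first [apply: Ha | apply: Hb] => //=; exact: leqW.
Qed.

Lemma shuffleC a b : shuffle a b = shuffle b a.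
Proof.
apply: funext => nu; elim: nu a b => [|x nu IH] a b.
  by rewrite !shuffle_nil mulrC.
by rewrite !shuffle_cons addrC IH [X in _ + X]IH.
Qed.

Lemma shuffleDl a b c :
  shuffle (fun w => a w + b w) c = fun w => shuffle a c w + shuffle b c w.
Proof.
apply: funext => nu; elim: nu a b c => [|x nu IH] a b c.
  by rewrite !shuffle_nil mulrDl.
rewrite !shuffle_cons -[lder x (fun _ => _)]/(fun w => lder x a w + lder x b w).
by rewrite !IH addrACA.
Qed.

Lemma shuffleZl t a b :
  shuffle (fun w => t * a w) b = fun w => t * shuffle a b w.
Proof.
apply: funext => nu; elim: nu a b => [|x nu IH] a b.
  by rewrite !shuffle_nil mulrA.
rewrite !shuffle_cons -[lder x (fun _ => _)]/(fun w => t * lder x a w).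
by rewrite !IH mulrDr.
Qed.

Lemma shuffle0l b : shuffle (fun=> 0) b = fun=> 0.
Proof.
apply: funext => nu; transitivity (shuffle (fun w => 0 * (fun=> 0) w) b nu).
  by congr (shuffle _ _ nu); apply: funext => w; rewrite mul0r.
by rewrite shuffleZl mul0r.
Qed.

Lemma shuffleDr a b c :
  shuffle a (fun w => b w + c w) = fun w => shuffle a b w + shuffle a c w.
Proof. by rewrite shuffleC shuffleDl; apply: funext => w; rewrite !(shuffleC a). Qed.

Lemma shuffleZr t a b :
  shuffle a (fun w => t * b w) = fun w => t * shuffle a b w.
Proof. by rewrite shuffleC shuffleZl shuffleC. Qed.

Lemma shuffle0r a : shuffle a (fun=> 0) = fun=> 0.
Proof. by rewrite shuffleC shuffle0l. Qed.

Lemma shuffle_suml (I : finType) (f : I -> sser K m) b :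
  shuffle (fun w => \sum_i f i w) b = fun w => \sum_i shuffle (f i) b w.
Proof.
have E (s : seq I) : shuffle (fun w => \sum_(i <- s) f i w) b =
    fun w => \sum_(i <- s) shuffle (f i) b w.
  elim: s => [|i s IH].
    transitivity (shuffle (fun=> 0) b).
      by congr (shuffle _ _); apply: funext => w; rewrite big_nil.
    by rewrite shuffle0l; apply: funext => w; rewrite big_nil.
  transitivity (shuffle (fun w => f i w + \sum_(j <- s) f j w) b).
    by congr (shuffle _ _); apply: funext => w; rewrite big_cons.
  by rewrite shuffleDl IH; apply: funext => w; rewrite big_cons.
exact: E.
Qed.

Lemma shuffle_sumr (I : finType) a (f : I -> sser K m) :
  shuffle a (fun w => \sum_i f i w) = fun w => \sum_i shuffle a (f i) w.
Proof.
by rewrite shuffleC shuffle_suml; apply: funext => w; apply: eq_bigr => i _; rewrite shuffleC.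
Qed.

Lemma lder_shuffle x a b : lder x (shuffle a b) =
  fun w => shuffle (lder x a) b w + shuffle a (lder x b) w.
Proof. by apply: funext => w; exact: shuffle_cons. Qed.

Lemma shuffleA a b c : shuffle a (shuffle b c) = shuffle (shuffle a b) c.
Proof.
apply: funext => nu; elim: nu a b c => [|x nu IH] a b c.
  by rewrite !shuffle_nil mulrA.
by rewrite !shuffle_cons !lder_shuffle shuffleDl shuffleDr !IH addrA.
Qed.

Lemma shuffleCA a b c : shuffle a (shuffle b c) = shuffle b (shuffle a c).
Proof. by rewrite shuffleA (shuffleC a b) -shuffleA. Qed.

End Shuffle.

Section MixedComposition.
Variables (K : numFieldType) (m : nat).
Implicit Types (a b c : sser K m) (d e : ser K m) (u v w nu : word m).

Definition scomp c d : sser K m := fun nu =>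
  \sum_(k < (size nu).+1) sumw k (fun eta => c eta * phi d eta nu).

Lemma mixcompE (c d : ser K m) nu j : mixcomp c d nu j = scomp (fun w => c w j) d nu.
Proof. by []. Qed.

Lemma phi_cons d x eta nu : phi d (x :: eta) nu =
  lcons x (phi d eta) nu + lcons ord0 (shuffle (Defs.comp d x) (phi d eta)) nu.
Proof. by []. Qed.

Lemma phi_small d eta nu : (size nu < size eta)%N -> phi d eta nu = 0.
Proof.
elim: eta nu => [//|x eta IH] [|y nu] Hs; rewrite phi_cons /= ?addr0 //.
move: Hs; rewrite ltnS => Hs.
rewrite IH // if_same add0r.
rewrite (@eq_shuffle _ _ _ _ (Defs.comp d x) (fun=> 0)) ?shuffle0r ?if_same //.
by move=> w Hw; apply: IH; exact: leq_ltn_trans Hw Hs.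
Qed.

(** A common truncation bound for all words up to a given length; it lets the sum over [eta] be
    exchanged with a shuffle product. *)
Lemma scomp_widen c d nu n : (size nu < n)%N ->
  scomp c d nu = \sum_(k < n) sumw k (fun eta => c eta * phi d eta nu).
Proof.
move=> Hn; rewrite /scomp.
rewrite (big_ord_widen n (fun k => sumw k (fun eta => c eta * phi d eta nu))) //.
rewrite [RHS](bigID (fun k : 'I_n => (k < (size nu).+1)%N)) /=.
rewrite [X in _ + X]big1 ?addr0 // => k; rewrite -leqNgt => Hk.
rewrite -[RHS](sumw_const0 K m k); apply: eq_sumw_size => w Hw.
by rewrite phi_small ?mulr0 // Hw.
Qed.

Lemma scomp_nil c d : scomp c d [::] = c [::].
Proof. by rewrite /scomp big_ord1 sumw0 mulr1. Qed.

Lemma shuffle_scomp a c d nu n : (size nu < n)%N ->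
  shuffle a (scomp c d) nu =
  \sum_(k < n) sumw k (fun eta => c eta * shuffle a (phi d eta) nu).
Proof.
move=> Hn.
rewrite (@eq_shuffle _ _ _ _ a
  (fun w => \sum_(k < n) sumw k (fun eta => c eta * phi d eta w))) //; last first.
  by move=> w Hw; apply: scomp_widen; exact: leq_ltn_trans Hw Hn.
rewrite shuffle_sumr; apply: eq_bigr => k _.
rewrite /sumw shuffle_sumr; apply: eq_bigr => eta _.
by rewrite shuffleZr.
Qed.

(** Split off the first letter [x] of [eta]. Of the two summands of [phi_letter], the first
    contributes only for [x = y], the second only for [y = ord0]. *)
Lemma scomp_cons c d y nu :
  scomp c d (y :: nu) = scomp (lder y c) d nu +
    (if y == ord0 then \sum_x shuffle (Defs.comp d x) (scomp (lder x c) d) nu else 0).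
Proof.
rewrite /scomp /= big_ord_recl sumw0 mulr0 add0r.
pose F1 (x : 'I_m.+1) eta := lder x c eta * (if y == x then phi d eta nu else 0).
pose F2 (x : 'I_m.+1) eta := lder x c eta *
  (if y == ord0 then shuffle (Defs.comp d x) (phi d eta) nu else 0).
transitivity (\sum_(k < (size nu).+1) \sum_x (sumw k (F1 x) + sumw k (F2 x))).
  apply: eq_bigr => k _; rewrite (sumwS k (fun eta => c eta * phi d eta (y :: nu))).
  apply: eq_bigr => x _.
  by rewrite -sumwD; apply: eq_sumw => eta; rewrite phi_cons /= mulrDr.
transitivity (\sum_(k < (size nu).+1) \sum_x sumw k (F1 x) +
              \sum_(k < (size nu).+1) \sum_x sumw k (F2 x)).
  by rewrite -big_split; apply: eq_bigr => k _; rewrite big_split.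
congr (_ + _).
  apply: eq_bigr => k _; rewrite (bigD1 y) //= [X in _ + X]big1 ?addr0.
    by apply: eq_sumw => eta; rewrite /F1 eqxx.
  by move=> x /negPf xy; rewrite /sumw big1 // => v _; rewrite /F1 eq_sym xy mulr0.
rewrite exchange_big /=; case: ifP => y0; last first.
  rewrite big1 // => x _; rewrite big1 // => k _; rewrite /sumw big1 // => v _.
  by rewrite /F2 y0 mulr0.
apply: eq_bigr => x _; rewrite (@shuffle_scomp _ _ _ _ (size nu).+1) //.
by apply: eq_bigr => k _; apply: eq_sumw => eta; rewrite /F2 y0.
Qed.

Lemma scompD a b d :
  scomp (fun w => a w + b w) d = fun w => scomp a d w + scomp b d w.
Proof.
apply: funext => nu; rewrite /scomp -big_split; apply: eq_bigr => k _ /=.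
by rewrite -sumwD; apply: eq_sumw => eta; rewrite mulrDl.
Qed.

Lemma scompZ t a d : scomp (fun w => t * a w) d = fun w => t * scomp a d w.
Proof.
apply: funext => nu; rewrite /scomp big_distrr; apply: eq_bigr => k _ /=.
by rewrite -sumwMl; apply: eq_sumw => eta; rewrite mulrA.
Qed.

Lemma scomp0 d : scomp (fun=> 0) d = fun=> 0.
Proof.
apply: funext => nu; rewrite /scomp big1 // => k _; rewrite /sumw big1 // => v _.
by rewrite mul0r.
Qed.

Lemma scomp_sum (I : finType) (f : I -> sser K m) d :
  scomp (fun w => \sum_i f i w) d = fun w => \sum_i scomp (f i) d w.
Proof.
apply: funext => nu; rewrite /scomp [RHS]exchange_big; apply: eq_bigr => k _ /=.
by rewrite -sumw_sum; apply: eq_sumw => eta; rewrite mulr_suml.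
Qed.

Lemma eq_comp d d' x w : (forall j, d w j = d' w j) -> Defs.comp d x w = Defs.comp d' x w.
Proof. by rewrite /Defs.comp => H; case: unlift. Qed.

Lemma eq_scomp c c' d d' nu :
  (forall w, (size w <= size nu)%N -> c w = c' w) ->
  (forall w j, (size w < size nu)%N -> d w j = d' w j) ->
  scomp c d nu = scomp c' d' nu.
Proof.
have [n] := ubnP (size nu); elim: n nu c c' => // n IH [|y nu] c c' Hn Hc Hd.
  by rewrite !scomp_nil Hc.
have D w : (size w <= size nu)%N -> forall c c',
    (forall w, (size w <= (size nu).+1)%N -> c w = c' w) -> forall x,
    scomp (lder x c) d w = scomp (lder x c') d' w.
  move=> Hw {Hc}c {}c' Hc x; apply: IH; first exact: leq_ltn_trans Hw _.
    by move=> v Hv; apply: Hc; rewrite /= ltnS; exact: leq_trans Hv Hw.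
  by move=> v j Hv; apply: Hd; rewrite /= ltnS; exact: leq_trans (ltnW Hv) Hw.
rewrite !scomp_cons; congr (_ + _); first exact: D.
case: ifP => // _; apply: eq_bigr => x _; apply: eq_shuffle => w Hw.
  by apply: eq_comp => j; apply: Hd.
exact: D.
Qed.

Lemma lder_scomp c d y : lder y (scomp c d) = fun w => scomp (lder y c) d w +
    (if y == ord0 then \sum_x shuffle (Defs.comp d x) (scomp (lder x c) d) w else 0).
Proof. by apply: funext => w; exact: scomp_cons. Qed.

(** Both sides obey the same recursion on first letters; the correction terms at [ord0] agree by
    associativity and commutativity of the shuffle product. *)
Lemma scomp_shuffle a b d : scomp (shuffle a b) d = shuffle (scomp a d) (scomp b d).
Proof.
apply: funext => nu.
have [n] := ubnP (size nu); elim: n nu a b => // n IH [|y nu] a b Hn.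
  by rewrite shuffle_nil !scomp_nil shuffle_nil.
rewrite scomp_cons shuffle_cons !lder_scomp shuffleDl shuffleDr lder_shuffle scompD.
rewrite !IH // addrACA; congr (_ + _).
case: ifP => _; last by rewrite shuffle0l shuffle0r addr0.
rewrite shuffle_suml shuffle_sumr -big_split; apply: eq_bigr => x _ /=.
rewrite -shuffleA (shuffleCA (scomp a d)).
have -> : forall f g h : sser K m, shuffle f g nu + shuffle f h nu =
   shuffle f (fun w => g w + h w) nu by move=> f g h; rewrite shuffleDr.
apply: eq_shuffle => // w Hw; rewrite lder_shuffle scompD.
by rewrite !IH //; exact: leq_ltn_trans Hw _.
Qed.

Lemma comp_gmul d e x :
  Defs.comp (gmul d e) x = fun w => Defs.comp e x w + scomp (Defs.comp d x) e w.
Proof.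
apply: funext => w; rewrite /Defs.comp /gmul; case: unlift => [j|]; first by [].
by rewrite scomp0 addr0.
Qed.

(** The source of associativity in the group. In the recursion, [scomp_shuffle] carries the
    composition with [e] through the correction terms. *)
Lemma scompA c d e : scomp (scomp c d) e = scomp c (gmul d e).
Proof.
apply: funext => nu.
have [n] := ubnP (size nu); elim: n nu c => // n IH [|y nu] c Hn.
  by rewrite !scomp_nil.
rewrite !scomp_cons -IH // lder_scomp scompD -addrA; congr (_ + _).
case: ifP => _; last by rewrite scomp0 addr0.
rewrite scomp_sum -big_split; apply: eq_bigr => x _ /=.
rewrite comp_gmul shuffleDl scomp_shuffle addrC.
have Hs w : (size w <= size nu)%N ->
    scomp (scomp (lder x c) d) e w = scomp (lder x c) (gmul d e) w.
  by move=> Hw; apply: IH; exact: leq_ltn_trans Hw _.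
congr (_ + _); last by apply: eq_shuffle.
(* For [x = ord0] the component of [e] is zero; for any other [x] the left shift commutes with
   composition. *)
have [->|x0] := eqVneq x ord0; first by rewrite /Defs.comp unlift_none !shuffle0l.
apply: eq_shuffle => // w Hw; rewrite -Hs //.
by congr (scomp _ e w); apply: funext => v; rewrite lder_scomp (negPf x0) addr0.
Qed.

End MixedComposition.

(** * The group *)

Section Group.
Variables (K : numFieldType) (m : nat).
Implicit Types (a b c d e : ser K m) (nu : word m).

Lemma eqsP c d : eqs c d -> c = d.
Proof. by move=> E; apply: funext => nu; apply: funext => j; apply: E. Qed.

Lemma gmulA a b c : gmul (gmul a b) c = gmul a (gmul b c).
Proof.
apply: eqsP => nu j; rewrite /gmul !mixcompE -scompA scompD -addrA.
by congr (_ + (_ + _)).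
Qed.

Lemma gmul0c c : gmul (@gunit K m) c = c.
Proof. by apply: eqsP => nu j; rewrite /gmul mixcompE scomp0 addr0. Qed.

Lemma scompc0 (c : sser K m) nu : scomp c (@gunit K m) nu = c nu.
Proof.
elim: nu c => [|y nu IH] c; first by rewrite scomp_nil.
rewrite scomp_cons IH [X in _ + X](_ : _ = 0) ?addr0 //.
case: ifP => // _; rewrite big1 // => x _.
rewrite (_ : Defs.comp _ x = fun=> 0) ?shuffle0l //.
by apply: funext => w; rewrite /Defs.comp; case: unlift.
Qed.

Lemma gmulc0 c : gmul c (@gunit K m) = c.
Proof. by apply: eqsP => nu j; rewrite /gmul mixcompE scompc0 add0r. Qed.

(* The fixed point of [e = c ~o e_delta]; as the right-hand side at [nu] only
   involves [e] on shorter words, the iterates from [0] stabilize. *)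
Definition sol c : ser K m :=
  fun nu j => iter (size nu).+1 (mixcomp c) (@gunit K m) nu j.

Lemma iter_mixcomp_stable c n p nu j : (size nu < n)%N ->
  iter (n + p) (mixcomp c) (@gunit K m) nu j = iter n (mixcomp c) (@gunit K m) nu j.
Proof.
elim: n nu j => // n IH nu j Hn; rewrite addSn !iterS !mixcompE.
by apply: eq_scomp => // w i Hw; apply: IH; exact: leq_trans Hw _.
Qed.

Lemma sol_iter c n nu j : (size nu < n)%N ->
  sol c nu j = iter n (mixcomp c) (@gunit K m) nu j.
Proof. by move=> Hn; rewrite -(subnKC Hn) iter_mixcomp_stable. Qed.

Lemma solE c : sol c = mixcomp c (sol c).
Proof.
apply: eqsP => nu j; rewrite {1}/sol iterS !mixcompE.
by apply: eq_scomp => // w i Hw; rewrite -sol_iter.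
Qed.

Definition ginv c : ser K m := sol (fun nu j => - c nu j).

Lemma gmulcV c : gmul c (ginv c) = @gunit K m.
Proof.
apply: eqsP => nu j; rewrite /gmul {1}/ginv solE !mixcompE -/(ginv c).
rewrite (_ : (fun w => - c w j) = fun w => -1 * c w j) ?scompZ ?mulN1r ?addNr //.
by apply: funext => w; rewrite mulN1r.
Qed.

Lemma gmulVc c : gmul (ginv c) c = @gunit K m.
Proof.
(* The monoid argument: [c] and [ginv (ginv c)] are inverses of [ginv c] on opposite sides, hence
   equal. *)
have -> : gmul (ginv c) c = gmul (ginv c) (ginv (ginv c)); last exact: gmulcV.
by rewrite -{2}[c]gmulc0 -(gmulcV (ginv c)) -[gmul c _]gmulA gmulcV gmul0c.
Qed.

End Group.

(** * Growth estimates *)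

Section Majorants.
Variables (K : numFieldType).
Implicit Types (A B : nat -> K) (lam : K).

(** The Leibniz rule: if [A] and [B] list the derivatives at $0$ of two functions, [eprod A B] lists
    those of their product. *)
Fixpoint eprod A B n : K :=
  if n is n'.+1 then eprod (fun k => A k.+1) B n' + eprod A (fun k => B k.+1) n'
  else A 0%N * B 0%N.

Lemma eprodZ s t A B n :
  eprod (fun k => s * A k) (fun k => t * B k) n = s * t * eprod A B n.
Proof.
elim: n A B => [|n IH] A B /=; first by rewrite mulrACA.
by rewrite (IH (fun k => A k.+1)) (IH A (fun k => B k.+1)) mulrDr.
Qed.

(** For bounds depending only on the length of the word, [shuffle_cons] becomes the recursion of
    [eprod]. *)
Lemma shuffle_le m (a b : sser K m) A B nu :
  (forall w, (size w <= size nu)%N -> `|a w| <= A (size w)) ->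
  (forall w, (size w <= size nu)%N -> `|b w| <= B (size w)) ->
  `|shuffle a b nu| <= eprod A B (size nu).
Proof.
elim: nu a b A B => [|x nu IH] a b A B Ha Hb /=.
  by rewrite shuffle_nil normrM ler_pM // ?Ha ?Hb.
rewrite shuffle_cons (le_trans (ler_normD _ _)) // lerD // IH // => w Hw;
  by [apply: (Ha (x :: w)) | apply: (Hb (x :: w))
     | apply: Ha; exact: leqW | apply: Hb; exact: leqW].
Qed.

(* [halfpow lam a n / n!] is the [n]-th Taylor coefficient at [0] of
   [(1 - 2 lam t) ^ (- a / 2)]. *)
Definition halfpow lam a n : K := \prod_(i < n) (lam * (a + i.*2)%:R).

Lemma halfpow0 lam a : halfpow lam a 0 = 1.
Proof. exact: big_ord0. Qed.

Lemma halfpowS lam a n : halfpow lam a n.+1 = lam * a%:R * halfpow lam a.+2 n.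
Proof.
rewrite /halfpow big_ord_recl addn0; congr (_ * _); apply: eq_bigr => i _.
by rewrite /bump /= doubleS !addnS !addSn.
Qed.

(** This is $H^a H^b = H^{a+b}$ for $H = (1 - 2\lambda t)^{-1/2}$. *)
Lemma eprod_halfpow lam a b n :
  eprod (halfpow lam a) (halfpow lam b) n = halfpow lam (a + b) n.
Proof.
elim: n a b => [|n IH] a b /=; first by rewrite !halfpow0 mulr1.
have E c : (fun k => halfpow lam c k.+1) = fun k => lam * c%:R * halfpow lam c.+2 k.
  by apply: funext => k; rewrite halfpowS.
have E1 c : halfpow lam c = fun k => 1 * halfpow lam c k.
  by apply: funext => k; rewrite mul1r.
rewrite !E (E1 b) (E1 a) !eprodZ !IH halfpowS !addnS !addSn.
by rewrite -mulrDl mulr1 mul1r -mulrDr -natrD.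
Qed.

Lemma halfpow_ge0 lam a n : 0 <= lam -> 0 <= halfpow lam a n.
Proof. by move=> ?; apply: prodr_ge0 => i _; rewrite mulr_ge0. Qed.

Lemma halfpow_leS lam a n : 0 <= lam -> halfpow lam a n <= halfpow lam a.+1 n.
Proof.
move=> l0; apply: ler_prod => i _; rewrite mulr_ge0 //= ler_wpM2l // ler_nat.
by rewrite addSn.
Qed.

Lemma prod_mulS_fact (M : K) n : \prod_(i < n) (M * i.+1%:R) = M ^+ n * n`!%:R.
Proof.
elim: n => [|n IH]; first by rewrite big_ord0 mulr1.
by rewrite big_ord_recr /= IH exprSr factS natrM; ring.
Qed.

(** Together with [halfpow_le] this translates between growth $M^n n!$ and the majorants; the
    factors $2i+1$ lie between $i+1$ and $2(i+1)$. *)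
Lemma halfpow_ge M lam n : 0 <= M -> M <= lam -> M ^+ n * n`!%:R <= halfpow lam 1 n.
Proof.
move=> M0 Ml; rewrite -prod_mulS_fact; apply: ler_prod => i _.
by rewrite mulr_ge0 //= ler_pM // ler_nat add1n ltnS -addnn leq_addr.
Qed.

Lemma halfpow_le lam n : 0 <= lam -> halfpow lam 1 n <= (lam *+ 2) ^+ n * n`!%:R.
Proof.
move=> l0; rewrite -prod_mulS_fact; apply: ler_prod => i _.
rewrite mulr_ge0 //= -(mulr_natr lam) -mulrA ler_wpM2l // -natrM ler_nat.
by rewrite mul2n doubleS add1n ltnW.
Qed.

(* With [H = halfpow lam 1] of generating function [(1 - 2 lam t)^(-1/2)], so
   that [H' = lam H^3], the series [B M^k k! H^(k+1)] is a supersolution of the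
   equation satisfied by the composition of the [k]-th derivative of
   [B / (1 - M t)] with [B H]. *)
Lemma scomp_le m (M B lam : K) (d : ser K m) (c : sser K m) k nu :
  0 <= M -> 0 <= B -> M * (1 + m.+1%:R * B) <= lam ->
  (forall w j, `|d w j| <= B * halfpow lam 1 (size w)) ->
  (forall w, `|c w| <= B * M ^+ (size w + k) * (size w + k)`!%:R) ->
  `|scomp c d nu| <= B * M ^+ k * k`!%:R * halfpow lam k.+1 (size nu).
Proof.
move=> M0 B0 lamE Hd.
have lam0 : 0 <= lam by apply: le_trans lamE; rewrite mulr_ge0 // addr_ge0 // mulr_ge0.
have [n] := ubnP (size nu); elim: n nu c k => // n IH [|y nu] c k Hn Hc.
  by rewrite scomp_nil halfpow0 mulr1; apply: Hc [::].
have IHx x w : (size w <= size nu)%N -> `|scomp (lder x c) d w| <=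
    B * M ^+ k.+1 * k.+1`!%:R * halfpow lam k.+2 (size w).
  move=> Hw; apply: IH; first exact: leq_ltn_trans Hw _.
  by move=> v; rewrite addnS; apply: (Hc (x :: v)).
set q := B * M ^+ k.+1 * k.+1`!%:R in IHx.
have q0 : 0 <= q by rewrite !mulr_ge0 // exprn_ge0.
set h := halfpow lam k.+3 (size nu).
have h0 : 0 <= h by exact: halfpow_ge0.
have Hdx x w : `|Defs.comp d x w| <= B * halfpow lam 1 (size w).
  rewrite /Defs.comp; case: unlift => [j|]; first exact: Hd.
  by rewrite normr0 mulr_ge0 ?halfpow_ge0.
have S x : `|shuffle (Defs.comp d x) (scomp (lder x c) d) nu| <= B * q * h.
  rewrite /h -[k.+3]add1n -eprod_halfpow -eprodZ.
  by apply: shuffle_le => w Hw; [exact: Hdx|exact: IHx].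
rewrite scomp_cons (le_trans (ler_normD _ _)) //.
(* Raising the exponent of $H$ from $k+2$ to $k+3$ makes this term comparable with the shuffle
   terms. *)
have H1 : `|scomp (lder y c) d nu| <= q * h.
  by rewrite (le_trans (IHx _ _ _)) // ler_wpM2l // halfpow_leS.
have H2 : `|if y == ord0 then \sum_x shuffle (Defs.comp d x) (scomp (lder x c) d) nu else 0|
    <= m.+1%:R * (B * q * h).
  case: ifP => _; last by rewrite normr0 mulr_ge0 // mulr_ge0 // mulr_ge0.
  rewrite (le_trans (ler_norm_sum _ _ _)) //.
  rewrite (le_trans (ler_sum _ (fun x _ => S x))) // sumr_const card_ord.
  by rewrite mulr_natl.
rewrite (le_trans (lerD H1 H2)) // halfpowS -/h.
have -> : q * h + m.+1%:R * (B * q * h) =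
    B * M ^+ k * k`!%:R * k.+1%:R * h * (M * (1 + m.+1%:R * B)).
  by rewrite /q factS natrM exprS; ring.
have -> : B * M ^+ k * k`!%:R * (lam * k.+1%:R * h) =
    B * M ^+ k * k`!%:R * k.+1%:R * h * lam by ring.
by rewrite ler_wpM2l // !mulr_ge0 // exprn_ge0.
Qed.

End Majorants.

(** * Stability of local convergence under the group operations *)

Section LocalConvergence.
Variables (K : numFieldType) (m : nat).
Implicit Types (c d : ser K m).

Lemma LC_bound c : LC c -> exists M B, [/\ 0 < M, 0 <= B & bounded_by M B c].
Proof.
move=> [M [B [M0 H]]]; exists M, `|B|; split=> // nu j.
have q0 : 0 <= M ^+ size nu * (size nu)`!%:R by rewrite mulr_ge0 // exprn_ge0 // ltW.
(* [bounded_by] puts no sign on [B]; where its inequality holds, the right-hand side is nonnegative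
   and so equals its norm. *)
have := H nu j; rewrite -!mulrA => Hnu; apply: le_trans (Hnu) _.
by rewrite -(ger0_norm (le_trans (normr_ge0 _) Hnu)) normrM (ger0_norm q0).
Qed.

Lemma bounded_byW (M B M' B' : K) c : 0 <= M -> 0 <= B -> M <= M' -> B <= B' ->
  bounded_by M B c -> bounded_by M' B' c.
Proof.
move=> M0 B0 MM BB H nu j; apply: le_trans (H nu j) _.
rewrite ler_wpM2r // ler_pM ?exprn_ge0 // lerXn2r // nnegrE //.
exact: le_trans MM.
Qed.

Lemma LC_bound2 c d : LC c -> LC d ->
  exists M B, [/\ 0 < M, 0 <= B, bounded_by M B c & bounded_by M B d].
Proof.
move=> /LC_bound[M1 [B1 [M10 B10 H1]]] /LC_bound[M2 [B2 [M20 B20 H2]]].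
exists (M1 + M2), (B1 + B2); split; rewrite ?addr_gt0 ?addr_ge0 //.
  by apply: bounded_byW H1 ; rewrite ?lerDl //; exact: ltW.
by apply: bounded_byW H2 ; rewrite ?lerDr //; exact: ltW.
Qed.

Lemma LC_lin (a b : K) c d : LC c -> LC d -> LC (fun nu j => a * c nu j + b * d nu j).
Proof.
move=> Hc Hd; have [M [B [M0 B0 H1 H2]]] := LC_bound2 Hc Hd.
exists M, ((`|a| + `|b|) * B); split=> // nu j.
rewrite -!mulrA mulrDl (le_trans (ler_normD _ _)) // !normrM lerD // ler_wpM2l //.
  by rewrite mulrA.
by rewrite mulrA.
Qed.

Lemma LCD c d : LC c -> LC d -> LC (fun nu j => c nu j + d nu j).
Proof.
move=> Hc Hd; have := LC_lin 1 1 Hc Hd.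
by congr LC; apply: eqsP => nu j; rewrite !mul1r.
Qed.

Lemma LCZ (t : K) c : LC c -> LC (fun nu j => t * c nu j).
Proof.
move=> Hc; have := LC_lin t 0 Hc Hc.
by congr LC; apply: eqsP => nu j; rewrite mul0r addr0.
Qed.

Lemma LCN c : LC c -> LC (fun nu j => - c nu j).
Proof.
move=> /(LCZ (-1)); congr LC; apply: eqsP => nu j; exact: mulN1r.
Qed.

Lemma LC_le c d : LC d -> (forall nu j, `|c nu j| <= `|d nu j|) -> LC c.
Proof.
by move=> [M [B [M0 H]]] cd; exists M, B; split=> // nu j; apply: le_trans (H _ _).
Qed.

Lemma LC0 : LC (@gunit K m).
Proof. by exists 1, 0; split=> // nu j; rewrite normr0 !mul0r. Qed.

Lemma LC_halfpow (B lam : K) c : 0 <= lam -> 0 <= B ->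
  (forall nu j, `|c nu j| <= B * halfpow lam 1 (size nu)) -> LC c.
Proof.
(* The summand [1] keeps the growth constant positive when [lam = 0]. *)
move=> lam0 B0 H; exists (lam *+ 2 + 1), B; split.
  by rewrite ltr_wpDl // mulrn_wge0.
move=> nu j; apply: le_trans (H nu j) _; rewrite -mulrA ler_wpM2l //.
apply: le_trans (halfpow_le _ lam0) _; rewrite ler_wpM2r // lerXn2r ?nnegrE //.
- by rewrite mulrn_wge0.
- by rewrite addr_ge0 // mulrn_wge0.
- by rewrite lerDl.
Qed.

(** The case [k = 0] of [scomp_le]: [mixcomp c] maps the series majorized by $BH$ into
    themselves. *)
Lemma mixcomp_halfpow (M B lam : K) c d :
  0 <= M -> 0 <= B -> M * (1 + m.+1%:R * B) <= lam -> bounded_by M B c ->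
  (forall w j, `|d w j| <= B * halfpow lam 1 (size w)) ->
  forall w j, `|mixcomp c d w j| <= B * halfpow lam 1 (size w).
Proof.
move=> M0 B0 lamE Hc Hd w j; rewrite mixcompE.
have := @scomp_le _ m M B lam d (fun w => c w j) 0 w M0 B0 lamE Hd.
rewrite expr0 fact0 !mulr1; apply => v; rewrite addn0; exact: Hc.
Qed.

Lemma LC_gmul c d : LC c -> LC d -> LC (gmul c d).
Proof.
move=> Hc Hd; have [M [B [M0 B0 H1 H2]]] := LC_bound2 Hc Hd.
apply: LCD => //; set lam := M * (1 + m.+1%:R * B).
have Ml : M <= lam by rewrite ler_peMr ?lerDl ?mulr_ge0 // ltW.
have l0 : 0 <= lam by apply: le_trans Ml; exact: ltW.
apply: (@LC_halfpow B lam) => //; apply: (@mixcomp_halfpow M) => //; first exact: ltW.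
move=> w j; apply: le_trans (H2 _ _) _; rewrite -mulrA ler_wpM2l // halfpow_ge //.
exact: ltW.
Qed.

Lemma LC_sol c : LC c -> LC (sol c).
Proof.
move=> /LC_bound[M [B [M0 B0 H]]]; set lam := M * (1 + m.+1%:R * B).
have l0 : 0 <= lam by rewrite mulr_ge0 ?addr_ge0 ?mulr_ge0 // ltW.
apply: (@LC_halfpow B lam) => // nu j; rewrite /sol.
(* All iterates starting from zero stay under the same majorant. *)
move: (size nu).+1 => n; elim: n nu j => [|n IH] nu j.
  by rewrite /= /gunit normr0 mulr_ge0 ?halfpow_ge0.
by rewrite iterS; apply: (@mixcomp_halfpow M) => //; exact: ltW.
Qed.

Lemma LC_ginv c : LC c -> LC (ginv c).
Proof. by move=> Hc; apply/LC_sol/LCN. Qed.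

Lemma gmul_is_group : is_group (@gmul K m) (@gunit K m) (@ginv K m).
Proof.
split; first exact: LC_gmul; split; first exact: LC0; split; first exact: LC_ginv.
split; first by move=> a b c _ _ _; rewrite gmulA.
by split=> c _; rewrite ?gmul0c ?gmulc0 ?gmulcV ?gmulVc.
Qed.

End LocalConvergence.

(** * Polynomial expressions and their majorants *)

Section PolynomialExpressions.
Variables (K : numFieldType) (m n : nat).

(* Polynomial expressions in the coefficients of a countable family of points:
   [Var l i w j] is the coefficient [(w, j)] of the [i]-th component of the
   [l]-th point.  Point [0] is the base point and point [k.+1] is the direction
   of the [k]-th derivative. *)
Inductive pexp :=
  | Cst of K
  | Var of nat & 'I_n & word m & 'I_m
  | Add of pexp & pexp
  | Mul of pexp & pexp.

Definition env := nat -> pt K m n.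
Implicit Types (p q : pexp) (r s : env).

Fixpoint eval p r : K :=
  match p with
  | Cst a => a
  | Var l i w j => r l i w j
  | Add p q => eval p r + eval q r
  | Mul p q => eval p r * eval q r
  end.

Fixpoint maj p r : K :=
  match p with
  | Cst a => `|a|
  | Var l i w j => r l i w j
  | Add p q => maj p r + maj q r
  | Mul p q => maj p r * maj q r
  end.

(** Only the base point is differentiated, with point [k.+1] as direction; earlier directions count
    as constants. *)
Fixpoint der k p : pexp :=
  match p with
  | Cst _ => Cst 0
  | Var l i w j => if l is 0 then Var k.+1 i w j else Cst 0
  | Add p q => Add (der k p) (der k q)
  | Mul p q => Add (Mul (der k p) q) (Mul p (der k q))
  end.

Fixpoint wf k N p : bool :=
  match p with
  | Cst _ => true
  | Var l _ w _ => (l <= k)%N && (size w <= N)%N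
  | Add p q | Mul p q => wf k N p && wf k N q
  end.

Definition nonneg r := forall l i w j, 0 <= r l i w j.
Definition env_norm r : env := fun l i w j => `|r l i w j|.
Definition env_add r s : env := fun l i w j => r l i w j + s l i w j.
Definition env_scale (t : K) r : env := fun l i w j => t * r l i w j.
Definition env_shift k (t : K) r : env := fun l =>
  if l is 0 then fun i w j => r 0%N i w j + t * r k.+1 i w j else r l.

Lemma env_norm_ge0 r : nonneg (env_norm r).
Proof. by move=> *; apply: normr_ge0. Qed.

Lemma maj_ge0 p r : nonneg r -> 0 <= maj p r.
Proof.
move=> r0; elim: p => //= p ? q ?; [exact: addr_ge0|exact: mulr_ge0].
Qed.

Lemma maj_le p r s : nonneg r -> (forall l i w j, r l i w j <= s l i w j) ->
  maj p r <= maj p s.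
Proof.
move=> r0 rs; elim: p => //= p Hp q Hq; first exact: lerD.
by rewrite ler_pM ?maj_ge0.
Qed.

Lemma eval_maj p r : `|eval p r| <= maj p (env_norm r).
Proof.
elim: p => //= p Hp q Hq; first by rewrite (le_trans (ler_normD _ _)) ?lerD.
by rewrite normrM ler_pM.
Qed.

Lemma eval_eq_wf k N p r s : wf k N p ->
  (forall l i w j, (l <= k)%N -> (size w <= N)%N -> r l i w j = s l i w j) ->
  eval p r = eval p s /\ maj p r = maj p s.
Proof.
move=> + rs; elim: p => //= [l i w j /andP[lk wN]|p Hp q Hq|p Hp q Hq].
- by rewrite rs.
- by move=> /andP[/Hp[-> ->] /Hq[-> ->]].
- by move=> /andP[/Hp[-> ->] /Hq[-> ->]].
Qed.

Lemma wfW k N p : wf k N p -> wf k.+1 N p.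
Proof.
elim: p => //= [l i w j /andP[lk ->]|p Hp q Hq|p Hp q Hq]; first by rewrite leqW.
  by move=> /andP[/Hp-> /Hq->].
by move=> /andP[/Hp-> /Hq->].
Qed.

Lemma wf_der k N p : wf k N p -> wf k.+1 N (der k p).
Proof.
elim: p => //= [[|l] i w j|p Hp q Hq|p Hp q Hq] //=.
- by rewrite leqnn.
- by move=> /andP[/Hp-> /Hq->].
- by move=> /andP[Wp Wq]; rewrite Hp // Hq // !wfW.
Qed.

(** Expanded in [r] and [h], the difference consists of the monomials containing [h]; taking norms
    term by term gives the bound. *)
Lemma eval_diff p r h :
  `|eval p (env_add r h) - eval p r| <=
  maj p (env_add (env_norm r) (env_norm h)) - maj p (env_norm r).
Proof.
elim: p => [a|l i w j|p Hp q Hq|p Hp q Hq] /=.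
- by rewrite !subrr normr0.
- by rewrite /env_add /env_norm [_ + h l i w j]addrC [_ + `|h l i w j|]addrC !addrK.
- have E (a b c d : K) : a + b - (c + d) = (a - c) + (b - d) by ring.
  by rewrite !E (le_trans (ler_normD _ _)) ?lerD.
move: Hp Hq (eval_maj p r) (eval_maj q r).
set a := eval p r; set b := eval q r; set a' := eval p _; set b' := eval q _.
set A := maj p (env_norm r); set B := maj q (env_norm r).
set A' := maj p _; set B' := maj q _ => HA HB Ha Hb.
have -> : a' * b' - a * b = (a' - a) * b + a * (b' - b) + (a' - a) * (b' - b) by ring.
have -> : A' * B' - A * B = (A' - A) * B + A * (B' - B) + (A' - A) * (B' - B) by ring.
rewrite (le_trans (ler_normD _ _)) // lerD ?normrM ?ler_pM //.
by rewrite (le_trans (ler_normD _ _)) // lerD ?normrM ?ler_pM.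
Qed.

(** Along this segment [maj p] is a polynomial in [t] with nonnegative coefficients, hence
    convex. *)
Lemma maj_convex p r s (t : K) : nonneg r -> nonneg s -> 0 <= t <= 1 ->
  maj p (env_add r (env_scale t s)) - maj p r <=
  t * (maj p (env_add r s) - maj p r).
Proof.
move=> r0 s0 /andP[t0 t1].
have rs0 : nonneg (env_add r (env_scale t s)).
  by move=> *; rewrite /env_add /env_scale addr_ge0 ?mulr_ge0.
have rs l i w j : r l i w j <= env_add r s l i w j by rewrite /env_add lerDl.
elim: p => [a|l i w j|p Hp q Hq|p Hp q Hq] /=.
- by rewrite !subrr mulr0.
- by rewrite /env_add /env_scale ![r l i w j + _]addrC !addrK.
- have E (a b c d : K) : a + b - (c + d) = (a - c) + (b - d) by ring.
  by rewrite !E mulrDr lerD.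
move: Hp Hq (maj_le p r0 rs) (maj_le q r0 rs) (maj_ge0 p r0) (maj_ge0 q r0)
  (maj_ge0 p rs0) (maj_ge0 q rs0).
set A := maj p r; set B := maj q r; set At := maj p _; set Bt := maj q _.
set A1 := maj p _; set B1 := maj q _ => HA HB A1A B1B A0 B0 At0 Bt0.
rewrite -subr_ge0.
have -> : t * (A1 * B1 - A * B) - (At * Bt - A * B) =
   (t * (A1 - A) - (At - A)) * (B + t * (B1 - B)) +
   At * (t * (B1 - B) - (Bt - B)) + t * (1 - t) * ((A1 - A) * (B1 - B)) by ring.
have pA : 0 <= t * (A1 - A) - (At - A) by rewrite subr_ge0.
have pB : 0 <= t * (B1 - B) - (Bt - B) by rewrite subr_ge0.
have qA : 0 <= A1 - A by rewrite subr_ge0.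
have qB : 0 <= B1 - B by rewrite subr_ge0.
have qt : 0 <= 1 - t by rewrite subr_ge0.
apply: addr_ge0; last exact: mulr_ge0 (mulr_ge0 _ _) (mulr_ge0 _ _).
apply: addr_ge0; apply: mulr_ge0 => //; apply: addr_ge0 => //.
exact: mulr_ge0.
Qed.

(** [maj (der k p)] is the derivative of the majorant, so what remains are terms of order at least
    two, all nonnegative. *)
Lemma maj_taylor k p r : nonneg r ->
  0 <= maj p (env_shift k 1 r) - maj p r - maj (der k p) r.
Proof.
move=> r0; elim: p => [a|[|l] i w j|p Hp q Hq|p Hp q Hq] /=.
- by rewrite subrr normr0 subr0.
- by rewrite mul1r [_ + r k.+1 i w j]addrC addrK subrr.
- by rewrite subrr normr0 subr0.
- have -> : forall a b c d e f : K, a + b - (c + d) - (e + f) =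
     (a - c - e) + (b - d - f) by move=> *; ring.
  exact: addr_ge0.
have -> : forall a b c d e f : K, a * b - c * d - (e * d + c * f) =
    e * f + (c + e) * (b - d - f) + (a - c - e) * (d + f) + (a - c - e) * (b - d - f).
  by move=> *; ring.
have A0 := maj_ge0 p r0; have B0 := maj_ge0 q r0.
have A1 := maj_ge0 (der k p) r0; have B1 := maj_ge0 (der k q) r0.
apply: addr_ge0; last exact: mulr_ge0.
apply: addr_ge0; last by apply: mulr_ge0 => //; exact: addr_ge0.
apply: addr_ge0; first exact: mulr_ge0.
by apply: mulr_ge0 => //; exact: addr_ge0.
Qed.

(** The remainder has a factor $t^2$; as $|t| \le 1$, bounding the other powers of $t$ by one leaves
    the remainder of the majorant at $t = 1$. *)
Lemma eval_taylor k p r (t : K) : `|t| <= 1 ->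
  `|eval p (env_shift k t r) - eval p r - t * eval (der k p) r| <=
  `|t| ^+ 2 * (maj p (env_shift k 1 (env_norm r)) - maj p (env_norm r)
               - maj (der k p) (env_norm r)).
Proof.
move=> t1; have t20 : 0 <= `|t| ^+ 2 by rewrite exprn_ge0.
elim: p => [a|[|l] i w j|p Hp q Hq|p Hp q Hq] /=.
- by rewrite !subrr mulr0 subr0 !normr0 subr0 mulr0.
- have E (a b : K) : a + b - a - b = 0 by ring.
  by rewrite mul1r !E normr0 mulr0.
- by rewrite !subrr mulr0 subr0 !normr0 subr0 mulr0.
- have -> : forall a b c d e f : K, a + b - (c + d) - t * (e + f) =
     (a - c - t * e) + (b - d - t * f) by move=> *; ring.
  have -> : forall a b c d e f : K, a + b - (c + d) - (e + f) =
     (a - c - e) + (b - d - f) by move=> *; ring.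
  by rewrite mulrDr (le_trans (ler_normD _ _)) ?lerD.
move: Hp Hq (eval_maj p r) (eval_maj q r) (eval_maj (der k p) r) (eval_maj (der k q) r).
set a := eval p r; set b := eval q r; set a2 := eval p _; set b2 := eval q _.
set a1 := eval (der k p) r; set b1 := eval (der k q) r.
set A := maj p (env_norm r); set B := maj q (env_norm r).
set A1 := maj (der k p) _; set B1 := maj (der k q) _.
set A2 := maj p _; set B2 := maj q _ => HA HB Ha Hb Ha1 Hb1.
set x := a2 - a - t * a1 in HA; set y := b2 - b - t * b1 in HB.
set X := A2 - A - A1 in HA; set Y := B2 - B - B1 in HB.
have -> : a2 * b2 - a * b - t * (a1 * b + a * b1) =
    t ^+ 2 * (a1 * b1) + a * y + x * b + t * (a1 * y) + t * (x * b1) + x * y.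
  by rewrite /x /y; ring.
have -> : A2 * B2 - A * B - (A1 * B + A * B1) =
    A1 * B1 + A * Y + X * B + A1 * Y + X * B1 + X * Y.
  by rewrite /X /Y; ring.
have A10 : 0 <= A1 by exact: le_trans Ha1.
have B10 : 0 <= B1 by exact: le_trans Hb1.
have t21 : `|t| ^+ 2 <= 1 by rewrite exprn_ile1.
have X0 : 0 <= X by apply: maj_taylor; exact: env_norm_ge0.
have Y0 : 0 <= Y by apply: maj_taylor; exact: env_norm_ge0.
move: x y X Y HA HB X0 Y0 => x y X Y HA HB X0 Y0; rewrite !mulrDr.
apply: le_trans (ler_normD _ _) _; apply: lerD; last first.
  by rewrite normrM mulrA ler_pM // (le_trans HB) // ler_piMl.
apply: le_trans (ler_normD _ _) _; apply: lerD; last first.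
  by rewrite normrM -[leRHS]mul1r ler_pM // normrM mulrA ler_pM.
apply: le_trans (ler_normD _ _) _; apply: lerD; last first.
  by rewrite normrM -[leRHS]mul1r ler_pM // normrM mulrCA ler_pM.
apply: le_trans (ler_normD _ _) _; apply: lerD; last first.
  by rewrite normrM mulrA ler_pM.
apply: le_trans (ler_normD _ _) _; apply: lerD; last first.
  by rewrite normrM mulrCA ler_pM.
by rewrite normrM normrX normrM ler_wpM2l // ler_pM.
Qed.

End PolynomialExpressions.

(** * The Silva topology *)

(** Put on norms because the order of [K] may be partial, as for complex numbers. *)
Definition archimedean (K : numFieldType) := forall x : K, exists k : nat, `|x| <= k%:R.

Section Growth.
Variables (K : numFieldType).
Implicit Types (a b : nat -> K).

(** The condition under which the box of [a] contains a ball of every $\ell_{\infty,M}$. *)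
Definition superexp a := forall M : K, 0 < M ->
  exists2 del : K, 0 < del & forall n, del * M ^+ n <= a n.

Lemma ex_minorant (x y : K) : 0 < x -> 0 < y -> exists z, [/\ 0 < z, z <= x & z <= y].
Proof.
move=> x0 y0; have [xy|/ltW yx] := real_leP (gtr0_real x0) (gtr0_real y0).
  by exists x.
by exists y.
Qed.

Lemma superexp_intro a : (forall n, 0 < a n) ->
  (forall M : K, 0 < M -> exists N, exists2 del : K, 0 < del &
     forall n, (N <= n)%N -> del * M ^+ n <= a n) ->
  superexp a.
Proof.
move=> a0 H M M0; have [N [del del0 Hdel]] := H M M0.
elim: N => [|N IH] in del del0 Hdel *; first by exists del => // n; apply: Hdel.
(* Lowering [del] below $a_N / M^N$ extends the bound to the index [N]. *)
have [z [z0 zd za]] := ex_minorant del0 (divr_gt0 (a0 N) (exprn_gt0 N M0)).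
apply: (IH z) => // n; rewrite leq_eqVlt => /orP[/eqP<-|Nn].
  by rewrite -ler_pdivlMr ?exprn_gt0.
by apply: le_trans (Hdel _ Nn); rewrite ler_wpM2r // exprn_ge0 // ltW.
Qed.

Lemma superexp_gt0 a n : superexp a -> 0 < a n.
Proof. by move=> /(_ 1 ltr01)[d d0 /(_ n)]; rewrite expr1n mulr1; apply: lt_le_trans. Qed.

Lemma ex_argmax (u : nat -> K) N : (forall k, 0 < u k) ->
  exists2 k, (k <= N)%N & forall i, (i <= N)%N -> u i <= u k.
Proof.
move=> u0; elim: N => [|N [k kN Hk]].
  by exists 0%N => // i; rewrite leqn0 => /eqP->.
have [le|/ltW le] := real_leP (gtr0_real (u0 k)) (gtr0_real (u0 N.+1)).
  exists N.+1 => // i; rewrite leq_eqVlt => /orP[/eqP->//|iN].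
  exact: le_trans (Hk i iN) le.
exists k; first exact: leqW.
by move=> i; rewrite leq_eqVlt => /orP[/eqP->//|]; apply: Hk.
Qed.

Hypothesis archK : archimedean K.

Lemma arch_le (x : K) : 0 <= x -> exists k : nat, x <= k.+1%:R.
Proof.
move=> x0; have [k] := archK x; rewrite ger0_norm // => xk; exists k.
by rewrite (le_trans xk) // ler_nat.
Qed.

Lemma arch_pow2 (x y : K) : 0 <= x -> 0 < y -> exists N : nat, x * (2^-1) ^+ N <= y.
Proof.
move=> x0 y0; have [N HN] := arch_le (divr_ge0 x0 (ltW y0)); exists N.+1.
rewrite exprVn ler_pdivrMr ?exprn_gt0 // mulrC -ler_pdivrMr //.
by rewrite (le_trans HN) // -natrX ler_nat ltnW // ltn_expl.
Qed.

End Growth.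

Section SilvaTopology.
Variables (K : numFieldType) (m : nat).
Hypothesis archK : archimedean K.
Implicit Types (a b : nat -> K) (c : ser K m) (W : ser K m -> Prop).

Definition box a c := LC c /\ forall nu j, `|c nu j| <= a (size nu) * (size nu)`!%:R.

Lemma box_nbhd0 a : superexp a -> nbhd0 (box a).
Proof.
move=> Ha; split; first by move=> c [].
split.
  move=> s t x y st [Hx Bx] [Hy By]; split; first exact: LC_lin.
  move=> nu j; rewrite (le_trans (ler_normD _ _)) // !normrM.
  set q := a _ * _.
  have q0 : 0 <= q by rewrite mulr_ge0 // ltW // superexp_gt0.
  apply: le_trans (lerD (ler_wpM2l _ (Bx nu j)) (ler_wpM2l _ (By nu j))) _ => //.
  by rewrite -mulrDl ler_piMl.
move=> M M0; have [d d0 Hd] := Ha M M0; exists d => // c Hc; split.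
  by exists M, d.
by move=> nu j; apply: le_trans (Hc nu j) _; rewrite ler_wpM2r.
Qed.

Lemma LC_nbhd0 : nbhd0 (@LC K m).
Proof.
split=> //; split; first by move=> s t x y _; apply: LC_lin.
by move=> M M0; exists 1 => // c Hc; exists M, 1.
Qed.

(* A series in the box is the convex combination
   [sum_n 2^-(n+1) (2^(n+1) c_n)] of its rescaled homogeneous parts; the tail is
   small in one of the Banach spaces. *)
Lemma nbhd0_box W : nbhd0 W ->
  exists2 a, superexp a & forall c, box a c -> W c.
Proof.
move=> [WLC [Wconv Wabs]].
have He k : exists e : K, 0 < e /\ forall c, bounded_by k.+1%:R e c -> W c.
  by have [e e0 He] := Wabs k.+1%:R (ltr0Sn _ _); exists e.
have [e He'] := choice He.
have e0 k : 0 < e k by case: (He' k).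
have eW k c : bounded_by k.+1%:R (e k) c -> W c by case: (He' k) => _; apply.
pose u n k := e k * k.+1%:R ^+ n.
have u0 n k : 0 < u n k by rewrite mulr_gt0 // exprn_gt0.
have Hkap n : exists k, forall i, (i <= n)%N -> u n i <= u n k.
  by have [k _ Hk] := ex_argmax n (u0 n); exists k.
have [kap Hkap'] := choice Hkap.
have h0 : 0 < 2^-1 :> K by rewrite invr_gt0.
(* At length [n] this bound places $2^{n+1} c_n$ in the ball of radius [e (kap n)], hence in [W]. *)
pose a n := (2^-1) ^+ n.+1 * u n (kap n).
exists a.
  apply: superexp_intro => [n|M M0]; first by rewrite mulr_gt0 ?exprn_gt0.
  (* The choice [2 M <= k.+1] absorbs the factor $2^{-n}$ in [a n]. *)
  have [k Hk] := arch_le archK (ltW (mulr_gt0 M0 (ltr0Sn K 1))).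
  exists k, (2^-1 * e k); first exact: mulr_gt0.
  move=> n kn; rewrite /a exprS -!mulrA ler_wpM2l ?(ltW h0) //.
  rewrite exprVn [leRHS]mulrC ler_pdivlMr ?exprn_gt0 // -mulrA -exprMn.
  apply: le_trans (Hkap' n k kn).
  by rewrite ler_wpM2l ?(ltW (e0 k)) // lerXn2r // ?nnegrE // mulr_ge0 // ltW.
move=> c [Hc Bc].
(* The tail from length [n] on, times $2^n$. It is the midpoint of $2^{n+1} c_n$ and [tl n.+1], so
   membership in [W] descends to [tl 0]. *)
pose tl n : ser K m := fun nu j => if (n <= size nu)%N then 2 ^+ n * c nu j else 0.
have WS n : W (tl n.+1) -> W (tl n).
  move=> Wn.
  pose hn : ser K m := fun nu j => if size nu == n then 2 ^+ n.+1 * c nu j else 0.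
  have Whn : W hn.
    apply: (eW (kap n)) => nu j; rewrite /hn; case: eqP => [E|_]; last first.
      by rewrite normr0 !mulr_ge0 ?exprn_ge0 // ltW.
    rewrite normrM normrX ger0_norm // mulrC -ler_pdivlMr ?exprn_gt0 //.
    apply: le_trans (Bc nu j) _; rewrite E /a /u exprVn.
    by rewrite [leRHS]mulrC !mulrA.
  have h1 : `|2^-1 : K| + `|2^-1 : K| <= 1.
    by rewrite ger0_norm ?(ltW h0) // -[X in X + X]mul1r -splitr.
  have := Wconv _ _ _ _ h1 Whn Wn; congr W; apply: eqsP => nu j; rewrite /hn /tl.
  have E2 : 2^-1 * (2 ^+ n.+1 * c nu j) = 2 ^+ n * c nu j.
    by rewrite mulrA exprS mulrA mulVf ?mul1r // pnatr_eq0.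
  case: (ltngtP n (size nu)) => _; rewrite ?mulr0 ?addr0 ?add0r //.
have [M [B [M0 B0 BM]]] := LC_bound Hc.
(* For lengths $s \ge N$ one has $2^N M^s \le 2^{-N} (4M)^s$; hence [4 M <= k.+1], and [N] with
   $B\,2^{-N} \le e_k$. *)
have [k Hk] := arch_le archK (mulr_ge0 (ler0n K 4) (ltW M0)).
have [N HN] := arch_pow2 archK B0 (e0 k).
have WN : W (tl N).
  apply: (eW k) => nu j; rewrite /tl; case: ifP => [Nn|_]; last first.
    by rewrite normr0 !mulr_ge0 ?exprn_ge0 // ltW.
  rewrite normrM normrX ger0_norm //.
  apply: le_trans (ler_wpM2l _ (BM nu j)) _; first exact: exprn_ge0.
  rewrite !mulrA ler_wpM2r //.
  apply: (@le_trans _ _ (B * (2^-1) ^+ N * (4 * M) ^+ size nu)).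
    rewrite exprMn exprVn !mulrA ler_wpM2r ?exprn_ge0 ?(ltW M0) //.
    rewrite mulrC -mulrA ler_wpM2l // mulrC ler_pdivlMr ?exprn_gt0 //.
    rewrite -exprMn -natrM; apply: ler_weXn2l => //; exact: (ler_nat K 1 4).
  rewrite ler_pM ?mulr_ge0 ?exprn_ge0 ?(ltW h0) ?mulr_ge0 ?(ltW M0) //.
  by rewrite lerXn2r // nnegrE // mulr_ge0 // ltW.
have W0 : W (tl 0%N) by elim: N WN {HN} => // N IH /WS.
by move: W0; congr W; apply: eqsP => nu j; rewrite /tl leq0n expr0 mul1r.
Qed.

End SilvaTopology.

(** * Analyticity of polynomial maps *)

Section PolynomialMaps.
Variables (K : numFieldType) (m n : nat).
Hypothesis archK : archimedean K.
Implicit Types (a b : nat -> K) (r s : env K m n) (Q : word m -> 'I_m -> pexp K m n).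

Definition LCenv r := forall l, LCp (r l).

Definition LCmaj Q := forall r, nonneg r -> LCenv r -> LC (fun nu j => maj (Q nu j) r).

Definition wfser k Q := forall nu j, wf k (size nu) (Q nu j).

Definition evser Q r : ser K m := fun nu j => eval (Q nu j) r.

Definition derser k Q : word m -> 'I_m -> pexp K m n := fun nu j => der k (Q nu j).

Lemma LCenv_norm r : LCenv r -> LCenv (env_norm r).
Proof. by move=> Hr l i; apply: LC_le (Hr l i) _ => nu j; rewrite normr_id. Qed.

Lemma LCenv_add r s : LCenv r -> LCenv s -> LCenv (env_add r s).
Proof. by move=> Hr Hs l i; apply: LCD (Hr l i) (Hs l i). Qed.

Lemma LCenv_shift k (t : K) r : LCenv r -> LCenv (env_shift k t r).
Proof.
by move=> Hr [|l] i /=; [apply: LCD (Hr _ i) (LCZ t (Hr _ i))|apply: Hr].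
Qed.

Lemma nonneg_shift k (t : K) r : 0 <= t -> nonneg r -> nonneg (env_shift k t r).
Proof. by move=> t0 r0 [|l] i w j /=; rewrite ?addr_ge0 ?mulr_ge0. Qed.

Lemma LC_evser Q r : LCmaj Q -> LCenv r -> LC (evser Q r).
Proof.
move=> HQ Hr; apply: LC_le (HQ _ (env_norm_ge0 r) (LCenv_norm Hr)) _ => nu j.
rewrite (le_trans (eval_maj _ _)) // real_ler_norm // ger0_real // maj_ge0 //.
exact: env_norm_ge0.
Qed.

(** By [maj_taylor] the majorant of the derivative is at most the majorant of [Q] at the base point
    shifted by the direction. *)
Lemma LCmaj_der k Q : LCmaj Q -> LCmaj (derser k Q).
Proof.
move=> HQ r r0 Hr.
have s0 := nonneg_shift k (@ler01 K) r0.
apply: LC_le (HQ _ s0 (LCenv_shift k 1 Hr)) _ => nu j.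
have := maj_taylor k (Q nu j) r0.
rewrite !ger0_norm ?maj_ge0 // subr_ge0 => H; apply: le_trans H _.
by rewrite lerBlDr lerDl maj_ge0.
Qed.

(** The extremal element of the box of [b]. For superexponential [b] it is in general not locally
    convergent, so it has to be approached in stages. *)
Definition radial b : env K m n := fun _ _ w _ => b (size w) * (size w)`!%:R.

(* [b] is assembled as [sum_k t_k (k+1)^n] restricted to [k <= n]; the factor
   [t_k] is chosen so small that by convexity of the majorants the [k]-th
   summand costs at most [2^-(k+1) a]. *)
Lemma maj_box k Q r a : LCmaj Q -> wfser k Q -> nonneg r -> LCenv r -> superexp a ->
  exists2 b, superexp b & forall nu j,
    maj (Q nu j) (env_add r (radial b)) - maj (Q nu j) r <= a (size nu) * (size nu)`!%:R.
Proof.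
move=> HQ wQ r0 Hr Ha.
have h0 : 0 < 2^-1 :> K by rewrite invr_gt0.
have h1 : 2^-1 <= 1 :> K by rewrite invf_le1 // (ler_nat K 1 2).
have hh (x : K) : 2^-1 * x + 2^-1 * x = x by rewrite -mulrDl -[X in X + X]mul1r -splitr mul1r.
pose cost b nu j := maj (Q nu j) (env_add r (radial b)) - maj (Q nu j) r.
pose Z N i : K := if (N <= i)%N then N.+1%:R ^+ i else 0.
pose expb b := exists M B : K, [/\ 0 < M, 0 <= B & forall i, b i <= B * M ^+ i].
(* After [N] stages the fraction $1 - 2^{-N}$ of the budget [a] may be spent; [expb b] keeps the
   stage locally convergent, so that [HQ] applies to it. *)
pose Inv N b := [/\ forall i, 0 <= b i,
  expb b &
  forall nu j, cost b nu j <= (1 - (2^-1) ^+ N) * (a (size nu) * (size nu)`!%:R)].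
have Z0 N i : 0 <= Z N i by rewrite /Z; case: ifP => // _; rewrite exprn_ge0.
have ZM N i : Z N i <= N.+1%:R ^+ i by rewrite /Z; case: ifP => // _; rewrite exprn_ge0.
have radLC b : (forall i, 0 <= b i) ->
    expb b -> LCenv (radial b).
  move=> b0 [M [B [M0 B0 Hb]]] l i; exists M, B; split=> // nu j.
  by rewrite /radial ger0_norm ?mulr_ge0 // ler_wpM2r.
have rad0 b : (forall i, 0 <= b i) -> nonneg (radial b).
  by move=> b0 l i w j; rewrite /radial mulr_ge0.
have bound b N (t : K) : 0 <= t -> expb b -> expb (fun i => b i + t * Z N i).
  move=> t0 [M [B [M0 B0 Hb]]]; exists (M + N.+1%:R), (B + t).
  split; rewrite ?addr_gt0 ?addr_ge0 // => i; rewrite mulrDl lerD //.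
    apply: le_trans (Hb i) _; rewrite ler_wpM2l // lerXn2r // ?nnegrE ?(ltW M0) ?lerDl //.
    by rewrite addr_ge0 // ltW.
  rewrite ler_wpM2l // (le_trans (ZM N i)) // lerXn2r // ?nnegrE ?lerDr ?(ltW M0) //.
  by rewrite addr_ge0 // ltW.
(* The invariant stands inside the existential so that [choice] gives a total step function, with
   default [0]. *)
have step (Nb : nat * (nat -> K)) : exists t : K, Inv Nb.1 Nb.2 ->
    0 < t /\ Inv Nb.1.+1 (fun i => Nb.2 i + t * Z Nb.1 i).
  case: Nb => N b /=.
  have [HI|nI] := pselect (Inv N b); last by exists 0.
  have [b0 bM bC] := HI.
  pose r' := env_add r (radial b).
  have r'0 : nonneg r' by move=> l i w j; rewrite addr_ge0 // rad0.
  have LCr' : LCenv r' by exact: LCenv_add (radLC _ b0 bM).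
  have LCZ' : LCenv (radial (Z N)).
    apply: radLC => //; exists N.+1%:R, 1; split=> // i; rewrite mul1r; exact: ZM.
  have s0 : nonneg (env_add r' (radial (Z N))) by move=> l i w j; rewrite addr_ge0 // rad0.
  have [M [B [M0 B0 HB]]] := LC_bound (HQ _ s0 (LCenv_add LCr' LCZ')).
  have [d d0 Hd] := Ha M M0.
  have hN : 0 < (2^-1 : K) ^+ N.+1 by rewrite exprn_gt0.
  have dB : 0 < d + B by rewrite ltr_wpDr.
  (* The quotient [d / (d + B)] gives both [t <= 1], for convexity, and $tB \le 2^{-(N+1)} d$, for
     the cost of the stage. *)
  pose t := (2^-1) ^+ N.+1 * (d / (d + B)).
  have dB1 : d / (d + B) <= 1 by rewrite ler_pdivrMr // mul1r lerDl.
  have t0 : 0 < t by rewrite mulr_gt0 // divr_gt0.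
  have t1 : t <= 1.
    by rewrite mulr_ile1 ?(ltW hN) ?divr_ge0 ?(ltW d0) ?(ltW dB) // exprn_ile1 // ltW.
  have tB : t * B <= (2^-1) ^+ N.+1 * d.
    rewrite -mulrA ler_wpM2l ?(ltW hN) // mulrAC ler_pdivrMr //.
    by rewrite ler_wpM2l ?(ltW d0) // lerDr ltW.
  exists t => _; split=> //; split=> [i||nu j].
  - by rewrite addr_ge0 // mulr_ge0 // ltW.
  - by apply: bound => //; exact: ltW.
  rewrite /cost.
  have -> : env_add r (radial (fun i => b i + t * Z N i)) =
      env_add r' (env_scale t (radial (Z N))).
    apply: funext => l; apply: funext => i; apply: funext => w; apply: funext => j'.
    by rewrite /env_add /radial /env_scale mulrDl addrA mulrA.
  set p := Q nu j; set A := a (size nu) * _.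
  have A0 : 0 <= A by rewrite mulr_ge0 // ltW // superexp_gt0.
  have t01 : 0 <= t <= 1 by rewrite (ltW t0).
  have C1 := maj_convex p r'0 (rad0 _ (Z0 N)) t01.
  have C2 : t * (maj p (env_add r' (radial (Z N))) - maj p r') <= (2^-1) ^+ N.+1 * A.
    apply: (@le_trans _ _ (t * maj p (env_add r' (radial (Z N))))).
      by rewrite ler_wpM2l ?(ltW t0) // lerBlDr lerDl maj_ge0.
    have := HB nu j; rewrite ger0_norm ?maj_ge0 // => H.
    apply: le_trans (ler_wpM2l (ltW t0) H) _.
    rewrite /A !mulrA ler_wpM2r //.
    apply: (@le_trans _ _ ((2^-1) ^+ N.+1 * d * M ^+ size nu)).
      by rewrite ler_wpM2r // exprn_ge0 // ltW.
    by rewrite -mulrA ler_wpM2l // ltW.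
  have -> : maj p (env_add r' (env_scale t (radial (Z N)))) - maj p r =
     (maj p (env_add r' (env_scale t (radial (Z N)))) - maj p r') + cost b nu j.
    by rewrite /cost -/p -/r' addrA subrK.
  apply: le_trans (lerD (le_trans C1 C2) (bC nu j)) _.
  have -> : (2^-1) ^+ N = (2^-1) ^+ N.+1 + (2^-1) ^+ N.+1 :> K by rewrite exprS hh.
  by rewrite -/A -mulrDl ler_wpM2r // opprD (addrCA 1) addNKr.
have [tau Htau] := choice step.
pose S := fix S N := if N is N'.+1 then fun i => S N' i + tau (N', S N') * Z N' i else fun=> 0.
have SS N i : S N.+1 i = S N i + tau (N, S N) * Z N i by [].
have Sinv N : Inv N (S N).
  elim: N => [|N IH]; last by have [] := Htau (N, S N) IH.
  split=> //; first by exists 1, 0; split=> // i; rewrite mul0r.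
  move=> nu j; rewrite expr0 subrr mul0r subr_le0.
  suff -> : env_add r (radial (S 0%N)) = r by [].
  apply: funext => l; apply: funext => i; apply: funext => w; apply: funext => j'.
  by rewrite /env_add /radial mul0r addr0.
have tau0 N : 0 < tau (N, S N) by have [] := Htau (N, S N) (Sinv N).
have Smono N p i : S N i <= S (N + p)%N i.
  elim: p => [|p IH]; first by rewrite addn0.
  by rewrite addnS SS (le_trans IH) // lerDl mulr_ge0 // ltW.
(* Later stages add only multiples of [Z N] with [N > i], which vanish at [i]. *)
have Sstab i p : S (i.+1 + p)%N i = S i.+1 i.
  elim: p => [|p IH]; first by rewrite addn0.
  have Z1 : Z (i.+1 + p)%N i = 0 by rewrite /Z ifN // -ltnNge addSn ltnS leq_addr.
  by rewrite addnS SS Z1 mulr0 addr0.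
pose b i := S i.+1 i.
have SZ N i : (N <= i)%N -> tau (N, S N) * N.+1%:R ^+ i <= b i.
  move=> Ni; apply: (@le_trans _ _ (S N.+1 i)).
    have -> : N.+1%:R ^+ i = Z N i by rewrite /Z Ni.
    by rewrite SS lerDr; case: (Sinv N).
  by rewrite /b -(subnKC Ni) -addSn; exact: Smono.
exists b.
  apply: superexp_intro => [i|M M0].
    by apply: lt_le_trans (SZ 0%N i _) => //; rewrite mulr_gt0 // exprn_gt0.
  have [N HN] := arch_le archK (ltW M0); exists N, (tau (N, S N)) => // i Ni.
  apply: le_trans (SZ N i Ni); rewrite ler_wpM2l ?(ltW (tau0 N)) //.
  by rewrite lerXn2r // nnegrE // ltW.
(* By [wfser] only entries up to [size nu] are read, and these are final at stage [(size nu).+1]. *)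
move=> nu j; have [_ _ /(_ nu j)] := Sinv (size nu).+1.
have [_ ->] : eval (Q nu j) (env_add r (radial b)) =
    eval (Q nu j) (env_add r (radial (S (size nu).+1))) /\
  maj (Q nu j) (env_add r (radial b)) =
    maj (Q nu j) (env_add r (radial (S (size nu).+1))).
  apply: (eval_eq_wf (wQ nu j)) => l i w j' _ wnu; rewrite /env_add /radial /b.
  by rewrite -(subnKC wnu) -addSn Sstab.
move=> H; apply: le_trans H _; set A := a _ * _.
have A0 : 0 <= A by rewrite mulr_ge0 // ltW // superexp_gt0.
by rewrite ler_piMl // lerBlDr lerDl exprn_ge0 // ltW.
Qed.

Lemma evser_box k Q r W : LCmaj Q -> wfser k Q -> LCenv r -> nbhd0 W ->
  exists2 V, nbhd0 V & forall s, LCenv s ->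
    (forall l i, (l <= k)%N -> V (fun nu j => s l i nu j - r l i nu j)) ->
    W (fun nu j => evser Q s nu j - evser Q r nu j).
Proof.
move=> HQ wQ Hr HW; have [a Ha HaW] := nbhd0_box archK HW.
have [b Hb Hab] := maj_box HQ wQ (env_norm_ge0 r) (LCenv_norm Hr) Ha.
exists (box b); first exact: box_nbhd0.
move=> s Hs Hsr; apply: HaW; split.
  exact: LCD (LC_evser HQ Hs) (LCN (LC_evser HQ Hr)).
move=> nu j.
(* Only points up to [k] are controlled; cutting off the others leaves the value unchanged, by
   [wfser], and puts [h] under [radial b]. *)
pose h : env K m n := fun l i w j => if (l <= k)%N then s l i w j - r l i w j else 0.
have [E _] : eval (Q nu j) s = eval (Q nu j) (env_add r h) /\
             maj (Q nu j) s = maj (Q nu j) (env_add r h).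
  apply: (eval_eq_wf (wQ nu j)) => l i w j' lk _.
  by rewrite /env_add /h lk addrC subrK.
rewrite /evser E; apply: le_trans (eval_diff _ _ _) _.
apply: le_trans (Hab nu j); rewrite lerB // maj_le //.
  by move=> *; rewrite /env_add /env_norm addr_ge0.
move=> l i w j'; rewrite /env_add lerD2l /env_norm /h.
case: ifP => lk; first by case: (Hsr l i lk) => _; apply.
by rewrite normr0 /radial mulr_ge0 // ltW // superexp_gt0.
Qed.

(** The Taylor remainder divided by [t] is at most [|t|] times one locally convergent series, so
    convergence takes place in a single $\ell_{\infty,M}$. *)
Lemma evser_derivable k Q r W : LCmaj Q -> LCenv r -> nbhd0 W ->
  exists2 del : K, 0 < del & forall t : K, 0 < `|t| < del ->
    W (fun nu j => (evser Q (env_shift k t r) nu j - evser Q r nu j) / t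
                   - evser (derser k Q) r nu j).
Proof.
move=> HQ Hr [_ [_ HW]].
have s0 : nonneg (env_shift k 1 (env_norm r)).
  by apply: nonneg_shift; [exact: ler01|exact: env_norm_ge0].
have [M [B [M0 B0 HB]]] := LC_bound (HQ _ s0 (LCenv_shift k 1 (LCenv_norm Hr))).
have [e e0 HeW] := HW M M0.
(* The bound [1] is for [eval_taylor]; [B + 1] replaces [B] to keep the denominator positive. *)
have [del [del0 del1 dele]] := ex_minorant (@ltr01 K) (divr_gt0 e0 (ltr_wpDl B0 (@ltr01 K))).
exists del => // t /andP[t0 tdel]; apply: HeW => nu j.
have t1 : `|t| <= 1 by exact: le_trans (ltW tdel) del1.
have tn : t != 0 by rewrite -normr_gt0.
rewrite /evser /derser.
have -> : (eval (Q nu j) (env_shift k t r) - eval (Q nu j) r) / t - eval (der k (Q nu j)) r =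
  (eval (Q nu j) (env_shift k t r) - eval (Q nu j) r - t * eval (der k (Q nu j)) r) / t.
  by rewrite [RHS]mulrBl [t * _]mulrC mulfK.
rewrite normrM normfV ler_pdivrMr //.
apply: le_trans (eval_taylor k (Q nu j) r t1) _.
rewrite expr2 -mulrA [leRHS]mulrC ler_wpM2l ?(ltW t0) //.
apply: (@le_trans _ _ (`|t| * maj (Q nu j) (env_shift k 1 (env_norm r)))).
  rewrite ler_wpM2l ?(ltW t0) // !lerBlDr -addrA lerDl.
  by rewrite addr_ge0 ?maj_ge0 //; exact: env_norm_ge0.
have := HB nu j; rewrite ger0_norm ?maj_ge0 // => H.
apply: le_trans (ler_wpM2l (ltW t0) H) _.
rewrite !mulrA ler_wpM2r // ler_wpM2r ?exprn_ge0 ?(ltW M0) //.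
have teB : `|t| * (B + 1) <= e.
  by rewrite -ler_pdivlMr ?ltr_wpDl // (le_trans (ltW tdel)).
by apply: le_trans teB; rewrite ler_wpM2l ?(ltW t0) // lerDl.
Qed.

Definition mkenv (x : pt K m n) (vs : nat -> pt K m n) : env K m n :=
  fun l => if l is l'.+1 then vs l' else x.

Lemma LCmaj_level0 Q : wfser 0 Q ->
  (forall x, LCp x -> LC (fun nu j => maj (Q nu j) (fun=> x))) -> LCmaj Q.
Proof.
move=> wQ HQ r r0 Hr; have := HQ _ (Hr 0%N); congr LC; apply: eqsP => nu j.
apply: (proj2 (eval_eq_wf (wQ nu j) _)) => l i w j'.
by rewrite leqn0 => /eqP->.
Qed.

(** The derivatives are the iterates of [derser], evaluated with [x] as point [0] and [vs] as
    directions. At level [0] any environment with base point [x] may stand for [x], such as the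
    constant one. *)
Lemma evser_Kanalytic Q (f : pt K m n -> ser K m) : wfser 0 Q ->
  (forall x, LCp x -> LC (fun nu j => maj (Q nu j) (fun=> x))) ->
  (forall x, evser Q (fun=> x) = f x) ->
  Kanalytic (@LCp K m n) (fun x (_ : 'I_1) => f x).
Proof.
move=> wQ HQ0 Qf; have HQ := LCmaj_level0 wQ HQ0.
split.
  split=> // x Hx; exists (fun _ => @LC K m); split; first by move=> _; exact: LC_nbhd0.
  by move=> y.
pose D := fix D k := if k is k'.+1 then derser k' (D k') else Q.
have wD k : wfser k (D k) by elim: k => // k IH nu j; exact: wf_der.
have LD k : LCmaj (D k) by elim: k => // k IH; exact: LCmaj_der.
have Lenv x vs : LCp x -> (forall l, LCp (vs l)) -> LCenv (mkenv x vs) by move=> ? ? [].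
exists (fun k x vs _ => evser (D k) (mkenv x vs)); split.
  move=> x vs Hx; apply: funext => i; rewrite -Qf; apply: eqsP => nu j.
  apply: (proj1 (eval_eq_wf (wQ nu j) _)) => l i' w j'.
  by rewrite leqn0 => /eqP->.
split; first by move=> k x vs Hx Hvs i; apply: LC_evser => //; exact: Lenv.
split.
  move=> k x vs Hx Hvs W HW.
  have [del d0 Hd] := evser_derivable k (LD k) (Lenv _ _ Hx Hvs) (HW ord0).
  exists del => // t Ht _ i; rewrite (ord1 i); have := Hd t Ht.
  congr (W ord0); apply: eqsP => nu j; congr ((evser _ _ nu j - _) / _ - _).
  by apply: funext => -[|l].
move=> k x vs Hx Hvs W HW.
have [V HV HVW] := evser_box (LD k) (wD k) (Lenv _ _ Hx Hvs) (HW ord0).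
exists (fun=> V), (fun _ _ => V).
split; first (by move=> _); split; first (by move=> l' i'); move=> y ws Hy Hws xy vws i.
rewrite (ord1 i); apply: HVW; first exact: Lenv.
by move=> [|l] i' lk /=; [apply: xy|apply: vws].
Qed.

End PolynomialMaps.

(** * Product and inverse as polynomial maps *)

Section Representability.
Variables (K : numFieldType) (m n N : nat).
Implicit Types (f g F G : pt K m n -> K).

(* [f] is a polynomial in the coefficients on words of length at most [N], and
   [F] is the polynomial obtained by replacing its constants by their norms. *)
Definition rep f F := exists p : pexp K m n, wf 0 N p /\
  forall x, eval p (fun=> x) = f x /\ maj p (fun=> x) = F x.

Lemma rep_ext f g F G : f =1 g -> F =1 G -> rep f F -> rep g G.
Proof. by move=> /funext-> /funext->. Qed.

Lemma rep_cst (a : K) : 0 <= a -> rep (fun=> a) (fun=> a).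
Proof. by move=> a0; exists (Cst _ _ a); split=> // x /=; rewrite ger0_norm. Qed.

Lemma rep_var i w j : (size w <= N)%N -> rep (fun x => x i w j) (fun x => x i w j).
Proof. by move=> wN; exists (Var _ 0 i w j). Qed.

Lemma rep_add f F g G : rep f F -> rep g G ->
  rep (fun x => f x + g x) (fun x => F x + G x).
Proof.
move=> [p [wp Hp]] [q [wq Hq]]; exists (Add p q); split=> [|x] /=; first by rewrite wp.
by have [-> ->] := Hp x; have [-> ->] := Hq x.
Qed.

Lemma rep_mul f F g G : rep f F -> rep g G ->
  rep (fun x => f x * g x) (fun x => F x * G x).
Proof.
move=> [p [wp Hp]] [q [wq Hq]]; exists (Mul p q); split=> [|x] /=; first by rewrite wp.
by have [-> ->] := Hp x; have [-> ->] := Hq x.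
Qed.

(** The constant [-1] has norm [1], so signs disappear in the majorant. *)
Lemma rep_opp f F : rep f F -> rep (fun x => - f x) F.
Proof.
move=> [p [wp Hp]]; exists (Mul (Cst _ _ (-1)) p); split=> [|x] //=.
by have [-> ->] := Hp x; rewrite mulN1r normrN normr1 mul1r.
Qed.

Lemma rep_sum (I : finType) (f F : I -> pt K m n -> K) : (forall i, rep (f i) (F i)) ->
  rep (fun x => \sum_i f i x) (fun x => \sum_i F i x).
Proof.
move=> H.
suff E (s : seq I) : rep (fun x => \sum_(i <- s) f i x) (fun x => \sum_(i <- s) F i x).
  exact: E.
elim: s => [|i s IH].
  by apply: rep_ext (rep_cst (lexx 0)) => x; rewrite big_nil.
by apply: rep_ext (rep_add (H i) IH) => x; rewrite big_cons.
Qed.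

Lemma rep_shuffle (a A b B : pt K m n -> sser K m) nu :
  (forall w, (size w <= size nu)%N -> rep (fun x => a x w) (fun x => A x w)) ->
  (forall w, (size w <= size nu)%N -> rep (fun x => b x w) (fun x => B x w)) ->
  rep (fun x => shuffle (a x) (b x) nu) (fun x => shuffle (A x) (B x) nu).
Proof.
elim: nu a A b B => [|y nu IH] a A b B Ha Hb.
  by apply: rep_ext (rep_mul (Ha [::] _) (Hb [::] _)) => // x; rewrite shuffle_nil.
pose la x := lder y (a x); pose lA x := lder y (A x).
pose lb x := lder y (b x); pose lB x := lder y (B x).
have H1 := IH la lA b B (fun w Hw => Ha (y :: w) Hw) (fun w Hw => Hb w (leqW Hw)).
have H2 := IH a A lb lB (fun w Hw => Ha w (leqW Hw)) (fun w Hw => Hb (y :: w) Hw).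
by apply: rep_ext (rep_add H1 H2) => x; rewrite shuffle_cons.
Qed.

(** The recursion [scomp_cons] uses only sums and products, so the majorant is given by the same
    formula. *)
Lemma rep_scomp (c C : pt K m n -> sser K m) (d D : pt K m n -> ser K m) nu :
  (forall w, (size w <= size nu)%N -> rep (fun x => c x w) (fun x => C x w)) ->
  (forall w j, (size w <= size nu)%N -> rep (fun x => d x w j) (fun x => D x w j)) ->
  rep (fun x => scomp (c x) (d x) nu) (fun x => scomp (C x) (D x) nu).
Proof.
have [k] := ubnP (size nu); elim: k nu c C => // k IH [|y nu] c C Hk Hc Hd.
  by apply: rep_ext (Hc [::] _) => // x; rewrite scomp_nil.
have Hl z w : (size w <= size nu)%N ->
    rep (fun x => scomp (lder z (c x)) (d x) w) (fun x => scomp (lder z (C x)) (D x) w).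
  move=> wnu; apply: (IH w (fun x => lder z (c x)) (fun x => lder z (C x))).
  - exact: leq_ltn_trans wnu _.
  - by move=> v vw; apply: (Hc (z :: v)); exact: leq_trans vw wnu.
  - by move=> v j vw; apply: Hd; exact: leq_trans vw (leqW wnu).
pose T (c : pt K m n -> sser K m) (d : pt K m n -> ser K m) x :=
  if y == ord0 then \sum_z shuffle (Defs.comp (d x) z) (scomp (lder z (c x)) (d x)) nu else 0.
have HT : rep (T c d) (T C D).
  rewrite /T; case: (y == ord0); last exact: rep_cst.
  apply: rep_sum => z; apply: rep_shuffle (Hl z) => w wnu.
  rewrite /Defs.comp; case: (unlift ord0 z) => [j|]; last exact: rep_cst.
  by apply: Hd; exact: leqW.
by apply: rep_ext (rep_add (Hl y nu (leqnn _)) HT) => x; rewrite scomp_cons.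
Qed.

Lemma rep_iter_mixcomp (c C : pt K m n -> ser K m) k nu j : (size nu <= N)%N ->
  (forall w j, (size w <= N)%N -> rep (fun x => c x w j) (fun x => C x w j)) ->
  rep (fun x => iter k (mixcomp (c x)) (@gunit K m) nu j)
      (fun x => iter k (mixcomp (C x)) (@gunit K m) nu j).
Proof.
move=> + Hc; elim: k nu j => [|k IH] nu j nuN; first exact: rep_cst.
apply: (@rep_ext (fun x => scomp (fun w => c x w j) (iter k (mixcomp (c x)) (@gunit K m)) nu) _
  (fun x => scomp (fun w => C x w j) (iter k (mixcomp (C x)) (@gunit K m)) nu)) => //.
apply: rep_scomp => [w wnu|w i wnu]; first by apply: Hc; exact: leq_trans nuN.
by apply: IH; exact: leq_trans nuN.
Qed.

End Representability.

Section Analyticity.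
Variables (K : numFieldType) (m : nat).
Hypothesis archK : archimedean K.

Lemma rep_Kanalytic n (f F : pt K m n -> ser K m) :
  (forall nu j, rep (size nu) (fun x => f x nu j) (fun x => F x nu j)) ->
  (forall x, LCp x -> LC (F x)) ->
  Kanalytic (@LCp K m n) (fun x (_ : 'I_1) => f x).
Proof.
move=> Hf HF.
have [Q HQ] := choice (fun nuj : word m * 'I_m => Hf nuj.1 nuj.2).
apply: (@evser_Kanalytic _ _ _ archK (fun nu j => Q (nu, j))) => [nu j|x Hx|x].
- by have [] := HQ (nu, j).
- have := HF x Hx; congr LC; apply: eqsP => nu j.
  by have [_ /(_ x)[_ E]] := HQ (nu, j).
- by apply: eqsP => nu j; have [_ /(_ x)[E _]] := HQ (nu, j).
Qed.

Lemma gmul_Kanalytic :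
  Kanalytic (@LCp K m 2) (fun x (_ : 'I_1) => gmul (x ord0) (x ord_max)).
Proof.
apply: (@rep_Kanalytic 2 (fun x => gmul (x ord0) (x ord_max))
                         (fun x => gmul (x ord0) (x ord_max))).
  move=> nu j; apply: rep_add; first exact: rep_var.
  apply: (@rep_scomp _ _ _ _ (fun x w => x ord0 w j) (fun x w => x ord0 w j)).
    by move=> w Hw; apply: rep_var.
  by move=> w i Hw; apply: rep_var.
by move=> x Hx; apply: LC_gmul.
Qed.

(** Dropping the sign in $e = -c \mathbin{\tilde\circ} e_\delta$ gives the majorant [sol], locally
    convergent by [LC_sol]. *)
Lemma ginv_Kanalytic : Kanalytic (@LCp K m 1) (fun x (_ : 'I_1) => ginv (x ord0)).
Proof.
apply: (@rep_Kanalytic 1 (fun x => ginv (x ord0)) (fun x => sol (x ord0))).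
  move=> nu j; apply: (@rep_iter_mixcomp _ _ _ _ (fun x w j => - x ord0 w j)) => //.
  by move=> w i Hw; apply/rep_opp/rep_var.
by move=> x Hx; apply: LC_sol.
Qed.

End Analyticity.

(** * Passage from real to complex scalars *)

Section BaseChange.
Variables (K L : numFieldType) (m : nat) (h : {rmorphism K -> L}).
Implicit Types (nu w : word m).

Lemma shuffle_map (a b : sser K m) nu :
  h (shuffle a b nu) = shuffle (fun w => h (a w)) (fun w => h (b w)) nu.
Proof.
elim: nu a b => [|x nu IH] a b; first by rewrite !shuffle_nil rmorphM.
by rewrite !shuffle_cons rmorphD !IH.
Qed.

Lemma scomp_map (c : sser K m) (d : ser K m) nu :
  h (scomp c d nu) = scomp (fun w => h (c w)) (fun w j => h (d w j)) nu.
Proof.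
have [k] := ubnP (size nu); elim: k nu c => // k IH [|y nu] c Hk.
  by rewrite !scomp_nil.
rewrite !scomp_cons rmorphD IH //; congr (_ + _).
case: ifP => _; last exact: rmorph0.
rewrite rmorph_sum; apply: eq_bigr => x _ /=; rewrite shuffle_map.
apply: eq_shuffle => w wnu.
  by rewrite /Defs.comp; case: unlift => // ; rewrite rmorph0.
by apply: IH; exact: leq_ltn_trans wnu _.
Qed.

Lemma gmul_map (c d : ser K m) nu j :
  h (gmul c d nu j) = gmul (fun w i => h (c w i)) (fun w i => h (d w i)) nu j.
Proof. by rewrite /gmul rmorphD !mixcompE scomp_map. Qed.

Lemma ginv_map (c : ser K m) nu j :
  h (ginv c nu j) = ginv (fun w i => h (c w i)) nu j.
Proof.
rewrite /ginv /sol; move: (size nu).+1 => k.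
elim: k nu j => [|k IH] nu j; first exact: rmorph0.
rewrite !iterS !mixcompE scomp_map; congr (scomp _ _ nu).
  by apply: funext => w; rewrite rmorphN.
by apply: eqsP => w i; exact: IH.
Qed.

End BaseChange.

Section Complexification.
Variables (R : realType) (m : nat).
Local Open Scope complex_scope.

Lemma archimedean_complex : archimedean R[i].
Proof.
move=> x; rewrite normc_def; set y := Num.sqrt _.
exists (Num.bound y); rewrite -(rmorph_nat (real_complex R)) lecR ltW //.
by apply: archi_boundP; exact: sqrtr_ge0.
Qed.

Lemma norm_real_complex (x : R) : `|x%:C| = `|x|%:C.
Proof. by rewrite normc_def /= expr0n addr0 sqrtr_sqr. Qed.

Lemma LCp_cplx n (x : pt R m n) : LCp x -> LCp (cplx x).
Proof.
move=> Hx i; have [M [B [M0 H]]] := Hx i; exists M%:C, B%:C; split.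
  by rewrite ltcR.
move=> nu j; rewrite /cplx norm_real_complex.
by rewrite -(rmorph_nat (real_complex R)) -rmorphXn -!rmorphM lecR.
Qed.

(** The complex map is the required extension, on the whole complexified space as open
    neighbourhood. *)
Lemma real_analytic_LCp n (f : pt R m n -> pt R m 1) (g : pt R[i] m n -> pt R[i] m 1) :
  Kanalytic (@LCp R[i] m n) g ->
  (forall x i nu j, g (cplx x) i nu j = (f x i nu j)%:C) ->
  real_analytic (@LCp R m n) f.
Proof.
move=> Hg gf; split.
  split=> // x Hx; exists (fun _ => @LC R m); split; first by move=> _; exact: LC_nbhd0.
  by move=> y.
exists (@LCp R[i] m n), g; split=> //; split; first exact: LCp_cplx.
by move=> x _ i nu j; exact: gf.
Qed.

End Complexification.

(* K = C (complex analytic Lie group) and K = R (real analytic Lie group) *)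
Theorem theorem5p1 (R : realType) (m : nat) :
  Lie_group (@Kanalytic R[i] m) (@gmul R[i] m) (@gunit R[i] m) /\
  Lie_group (@real_analytic R m) (@gmul R m) (@gunit R m).
Proof.
have Carch := @archimedean_complex R.
split.
  exists (@ginv R[i] m); split; first exact: gmul_is_group.
  by split; [exact: gmul_Kanalytic|exact: ginv_Kanalytic].
exists (@ginv R m); split; first exact: gmul_is_group.
split.
  (* Real and complex products are given by the same polynomials, so the embedding of scalars
     intertwines them. *)
  apply: real_analytic_LCp (gmul_Kanalytic m Carch) _ => x i nu j.
  by rewrite (gmul_map (real_complex R)).
apply: real_analytic_LCp (ginv_Kanalytic m Carch) _ => x i nu j.
by rewrite (ginv_map (real_complex R)).
Qed.
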